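(* Let $(T_\pm,\delta^* )$ be a thick locally finite Moufang twin tree satisfying condition (Comm). Let $A$ be the automorphism group of $(T_\pm,\delta^* )$, let $\Lambda\leq A$ be the subgroup generated by all root groups, and let $\Gamma$ be the stabilizer in $\Lambda$ of a vertex of $T_-$, viewed as a $T_+$-lattice via its action on $T_+$. Let $G=\mathrm{Aut}(T_+)$, let $G^\circ\leq G$ be the subgroup of all type-preserving automorphisms of $T_+$, and let $C(\Gamma)$ be the commensurator of $\Gamma$ in $G$. Then the closure of $C(\Gamma)$ in $G$ contains $G^\circ$. Therefore $C(\Gamma)$ is dense in $G$ if $T_+$ is not regular and also, in the case where $T_+$ is regular, if $A$ contains an automorphism interchanging the types of vertices.
   Context: Twin trees. A twin tree $(T_\pm,\delta^* )$ consists of two trees $T_+,T_-$ and a function $\delta^*$ with values in $\mathbf N=\{0,1,2,\dots\}$ on pairs of vertices of opposite signs such that, for all vertices $x_+$ of $T_+$ and $y_-$ of $T_-$: $\delta^*(x_+,y_-)=\delta^*(y_-,x_+)$; and, with $m=\delta^*(x_+,y_-)$, every neighbor $y_-'$ of $y_-$ satisfies $\delta^*(x_+,y_-')=m\pm1$, and if $m>0$ there is a unique neighbor $y_-'$ with $\delta^*(x_+,y_-')=m+1$; and the same conditions hold with $T_+$ and $T_-$ interchanged. It is thick if all vertices have degree at least 3, locally finite if $T_+$ and $T_-$ are. Two vertices of opposite signs are opposite if their codistance $\delta^*$ is $0$. An automorphism of $(T_\pm,\delta^* )$ is a pair $(\alpha_+,\alpha_-)$ of automorphisms of $T_+$ and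 $T_-$ with $\delta^*(\alpha_+(x_+),\alpha_-(y_-))=\delta^*(x_+,y_-)$ for all $x_+,y_-$; $A$ is the group of these automorphisms. Two vertices of the same sign have the same type if they are at even distance; two vertices of opposite signs have the same type if they are at even codistance; this gives two types. Twin apartments and twin roots. A twin apartment is a pair of geodesic lines $L_\pm\subset T_\pm$ such that every vertex of $L=L_+\cup L_-$ has a unique opposite in $L$. Number the vertices of $L_\pm$ as $(v_j^\pm)_{j\in\mathbf Z}$ with $v_j^\epsilon$ adjacent to $v_{j+1}^\epsilon$ and $v_j^+$ opposite $v_j^-$. The twin roots of $L$ with boundary $\{v_j^+,v_j^-\}$ are $\{v_i^+\}_{i\geq j}\cup\{v_i^-\}_{i\leq j}$ and $\{v_i^+\}_{i\leq j}\cup\{v_i^-\}_{i\geq j}$ (with the edges they span). Two twin roots $a,b$ of $L$ are prenilpotent if the half-lines $a\cap L_+$, $b\cap L_+$ are nested (one contains the other). Root groups, Moufang property. For a twin root $a$, $U_a$ is the group of automorphisms of $(T_\pm,\delta^* )$ fixing $a$ and every edge having a vertex in the interior of $a$ (i.e. a vertex of $a$ other than its two boundary vertices). $U_a$ is called a root group if it acts transitively on the set of twin apartments containing $a$. The twin tree is Moufang if there is a twin apartment $L$ such that $U_a$ is a root group for every twin root $a\subset L$; $\Lambda$ is the group generated by these $U_a$. Condition (Comm): for any two different prenilpotent twin roots $a,b$, the root groups $U_a$ and $U_b$ commute. Other notation. $G=\mathrm{Aut}(T_+)$ has the topology in which pointwise fixators of finite subtrees form a basis of open neighborhoods of the identity.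 $\Gamma$ is identified with its image in $G$. $C(\Gamma)=\{g\in G\mid \Gamma\cap g\Gamma g^{-1}\text{ has finite index in }\Gamma\text{ and in }g\Gamma g^{-1}\}$. $T_+$ is regular if all its vertices have the same degree ($T_+$ is always biregular, i.e. vertices of the same type have the same degree). *)

(* Defs.v *)
From HB Require Import structures.
From mathcomp Require Import all_boot all_order all_algebra.
From mathcomp Require Import all_classical topology.
Set Implicit Arguments.
Unset Strict Implicit.
Unset Printing Implicit Defensive.
Import Order.TTheory GRing.Theory Num.Theory.
Local Open Scope classical_set_scope.
Local Open Scope group_scope.

Record tree := Tree {
  vert :> choiceType;
  adj : rel vert;
  adj_sym : symmetric adj;
  adj_irr : irreflexive adj;
  tree_nonempty : exists x : vert, True;
  tree_connected : forall x y : vert, exists p, path adj x p /\ last x p = y;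
  tree_acyclic : forall c : seq vert, (2 < size c)%N -> ~ ucycle adj c
}.
Arguments adj {t} : rename.

Section Distance.
Variables (T : tree) (x y : T).

Let walk_of_length n := `[< exists p, [/\ path adj x p, last x p = y & size p = n] >].

Lemma walk_exists : exists n, walk_of_length n.
Proof.
by case: (tree_connected x y) => p [pp pl]; exists (size p); apply/asboolP; exists p.
Qed.

Definition dist : nat := ex_minn walk_exists.

Lemma distP n : dist = n <->
  (exists p, [/\ path adj x p, last x p = y & size p = n]) /\
  (forall p, path adj x p -> last x p = y -> (n <= size p)%N).
Proof.
rewrite /dist; case: ex_minnP => m /asboolP wm min_m; split=> [<-|[wn min_n]].
  by split=> // p pp pl; apply: min_m; apply/asboolP; exists p.
case: wm => p [pp pl sp]; apply/eqP; rewrite eqn_leq min_m; last exact/asboolP.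
by rewrite -sp min_n.
Qed.

End Distance.

Section TreeNotions.
Variable T : tree.

Definition nbrs (x : T) : set T := [set y | adj x y].

Definition locally_finite_tree := forall x : T, finite_set (nbrs x).

(* every degree, finite or not, is at least 3 *)
Definition thick_tree := forall x : T, (`I_3 #<= nbrs x)%card.

Definition regular_tree := forall x y : T, (nbrs x #= nbrs y)%card.

Definition same_type (x y : T) := ~~ odd (dist x y).

Definition finite_subtree (F : set T) :=
  [/\ finite_set F, F !=set0 &
   forall x y, F x -> F y ->
     exists p, [/\ path adj x p, last x p = y & forall z, z \in p -> F z]].

Definition geodesic (v : int -> T) :=
  forall i j : int, dist (v i) (v j) = `|(i - j)%R|%N.

Definition geodesic_line (L : set T) := exists2 v, geodesic v & L = range v.

End TreeNotions.

Record aut (T : tree) := Aut {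
  aut_fun :> T -> T;
  aut_inv : T -> T;
  aut_funK : cancel aut_fun aut_inv;
  aut_invK : cancel aut_inv aut_fun;
  aut_adj : forall x y, adj (aut_fun x) (aut_fun y) = adj x y
}.

HB.instance Definition _ (T : tree) := gen_eqMixin (aut T).
HB.instance Definition _ (T : tree) := gen_choiceMixin (aut T).

Section AutGroup.
Variable T : tree.
Implicit Types g h : aut T.

Lemma autP g h : g =1 h -> g = h.
Proof.
case: g h => [f f' fK f'K fA] [k k' kK k'K kA] /= fk.
have {}fk : f = k by apply/funext.
subst k; have {}fk' : f' = k' by apply/funext => x; rewrite -[LHS]kK f'K.
by subst k'; f_equal; apply: Prop_irrelevance.
Qed.

Definition aut_one : aut T := @Aut T id id (frefl _) (frefl _) (fun _ _ => erefl).

(* automorphisms act on the left: (g * h) x = g (h x) *)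
Definition aut_mul g h : aut T.
Proof.
apply: (@Aut T (g \o h) (aut_inv h \o aut_inv g)).
- exact: can_comp (aut_funK g) (aut_funK h).
- exact: can_comp (aut_invK h) (aut_invK g).
- by move=> x y /=; rewrite !aut_adj.
Defined.

Definition aut_V g : aut T.
Proof.
apply: (@Aut T (aut_inv g) g (aut_invK g) (aut_funK g)).
by move=> x y; rewrite -(aut_adj g) !aut_invK.
Defined.

Lemma aut_mulA : associative aut_mul. Proof. by move=> *; exact: autP. Qed.
Lemma aut_mul1 : left_id aut_one aut_mul. Proof. by move=> *; exact: autP. Qed.
Lemma aut_1mul : right_id aut_one aut_mul. Proof. by move=> *; exact: autP. Qed.
Lemma aut_mulV : left_inverse aut_one aut_V aut_mul.
Proof. by move=> g; apply: autP => x /=; rewrite aut_funK. Qed.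
Lemma aut_Vmul : right_inverse aut_one aut_V aut_mul.
Proof. by move=> g; apply: autP => x /=; rewrite aut_invK. Qed.

HB.instance Definition _ :=
  isGroup.Build (aut T) aut_mulA aut_mul1 aut_1mul aut_mulV aut_Vmul.

Lemma autM g h x : (g * h) x = g (h x). Proof. by []. Qed.
Lemma autV g x : g^-1 x = aut_inv g x. Proof. by []. Qed.
Lemma aut1 x : (1 : aut T) x = x. Proof. by []. Qed.

Definition fixator (F : set T) : set (aut T) := [set g | forall x, F x -> g x = x].

(* a set is open iff it contains, with each g, a translate g * fixator F *)
Definition aut_open (U : set (aut T)) :=
  forall g, U g -> exists2 F, finite_subtree F & forall h, fixator F h -> U (g * h).

Lemma finite_subtree_join (F1 F2 : set T) : finite_subtree F1 -> finite_subtree F2 ->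
  exists2 F, finite_subtree F & F1 `|` F2 `<=` F.
Proof.
move=> [fin1 [a F1a] c1] [fin2 [b F2b] c2].
have [p [pp pl]] := tree_connected a b.
have [q [qp ql]] := tree_connected b a.
have pq : path adj a (p ++ q) by rewrite cat_path pp pl.
have lpq : last a (p ++ q) = a by rewrite last_cat pl.
pose F := F1 `|` F2 `|` [set z | z \in a :: p ++ q].
pose R x y := exists p, [/\ path adj x p, last x p = y & forall z, z \in p -> F z].
have Rtrans x y z : R x y -> R y z -> R x z.
  move=> [r [rp rl rF]] [s [sp sl sF]]; exists (r ++ s).
  rewrite cat_path rp rl last_cat rl; split=> // t.
  by rewrite mem_cat => /orP[/rF|/sF].
have R1 x y : F1 x -> F1 y -> R x y.
  by move=> F1x /(c1 _ _ F1x)[r [? ? rF]]; exists r; split=> // z /rF ?; left; left.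
have R2 x y : F2 x -> F2 y -> R x y.
  by move=> F2x /(c2 _ _ F2x)[r [? ? rF]]; exists r; split=> // z /rF ?; left; right.
have RP x : x \in a :: p ++ q -> R a x /\ R x a.
  have PF z : z \in p ++ q -> F z by move=> zP; right; rewrite /= inE zP orbT.
  move: (p ++ q) pq lpq PF => r rp rl PF xr.
  case/splitPl: xr rp rl PF => r1 r2 lx; rewrite cat_path last_cat lx.
  move=> /andP[r1p r2p] lr PF; split; [exists r1|exists r2]; split=> // z zr.
    by apply: PF; rewrite mem_cat zr.
  by apply: PF; rewrite mem_cat zr orbT.
have Pb : b \in a :: p ++ q by rewrite -pl -cat_cons mem_cat mem_last.
have Ra x : F x -> R a x /\ R x a.
  case=> [[F1x|F2x]|/RP//]; first by split; exact: R1.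
  have [ab ba] := RP b Pb.
  by split; [apply: Rtrans ab _|apply: Rtrans _ ba]; exact: R2.
exists F => [|x Fx]; last by left.
split.
- by rewrite !finite_setU; split=> //; exact: finite_seq.
- by exists a; left; left.
- by move=> x y /Ra[_ xa] /Ra[ay _]; exact: Rtrans ay.
Qed.

Lemma fixatorS (F1 F2 : set T) : F1 `<=` F2 -> fixator F2 `<=` fixator F1.
Proof. by move=> sF g gF x /sF /gF. Qed.

Lemma finite_subtree1 (x : T) : finite_subtree [set x].
Proof.
split; [exact: finite_set1|by exists x|].
by move=> y z -> ->; exists [::].
Qed.

Lemma aut_openT : aut_open setT.
Proof.
move=> g _; case: (tree_nonempty T) => x _.
by exists [set x] => //; exact: finite_subtree1.
Qed.

Lemma aut_openI : setI_closed aut_open.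
Proof.
move=> U V oU oV g [/oU[F1 sF1 U1] /oV[F2 sF2 V2]].
have [F sF F12] := finite_subtree_join sF1 sF2.
have [F1F F2F] : F1 `<=` F /\ F2 `<=` F by rewrite -subUset.
exists F => // h hF; split; [apply: U1|apply: V2]; exact: fixatorS hF.
Qed.

Lemma aut_open_bigU (I : Type) (f : I -> set (aut T)) :
  (forall i, aut_open (f i)) -> aut_open (\bigcup_i f i).
Proof.
move=> of_ g [i _ /of_[F sF fF]].
by exists F => // h /fF ?; exists i.
Qed.

HB.instance Definition _ :=
  isOpenTopological.Build (aut T) aut_openT aut_openI aut_open_bigU.

Lemma aut_openE : (open : set (set (aut T))) = aut_open.
Proof. by []. Qed.

Lemma fixator_open (F : set T) : finite_subtree F -> open (fixator F).
Proof. by rewrite aut_openE; move=> sF g gF; exists F => // h hF x Fx; rewrite autM hF // gF. Qed.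

Lemma nbhs1_autE (U : set (aut T)) :
  nbhs (1 : aut T) U <-> exists2 F, finite_subtree F & fixator F `<=` U.
Proof.
split=> [|[F sF FU]].
  rewrite nbhsE => -[V [oV V1] VU]; have [F sF VF] := oV _ V1.
  by exists F => // h /VF; rewrite mul1g => /VU.
rewrite nbhsE; exists (fixator F) => //.
by split; [exact: fixator_open|move=> x].
Qed.

Definition type_preserving : set (aut T) := [set g | forall x, same_type x (g x)].

End AutGroup.

Section Subgroups.
Variable G : groupType.
Implicit Types H K S : set G.

Definition is_subgroup H :=
  [/\ H 1, forall x y, H x -> H y -> H (x * y) & forall x, H x -> H x^-1].

Definition generated S : set G := smallest is_subgroup S.

(* meant for a subgroup H of K: the set of left cosets x H, x in K, is finite *)
Definition finite_index H K :=
  finite_set [set [set x * h | h in H] | x in K].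

Definition conj_by (g : G) H : set G := [set g * h * g^-1 | h in H].

Definition commensurator H : set G :=
  [set g | finite_index (H `&` conj_by g H) H /\
           finite_index (H `&` conj_by g H) (conj_by g H)].

End Subgroups.

Definition codistance_axiom (T T' : tree) (d : T -> T' -> nat) :=
  forall (x : T) (y : T'),
    (forall y', adj y y' -> d x y' = (d x y).+1 \/ (d x y').+1 = d x y) /\
    ((0 < d x y)%N -> exists! y', adj y y' /\ d x y' = (d x y).+1).

(* the codistance is only given on T_+ x T_-; its value on T_- x T_+ is the
   transposed one *)
Record twin_tree := TwinTree {
  pos : tree;
  neg : tree;
  codist : pos -> neg -> nat;
  codist_pos : codistance_axiom codist;
  codist_neg : codistance_axiom (fun y x => codist x y)
}.
Arguments codist {t} : rename.

Section TwinTreeNotions.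
Variable TT : twin_tree.
Local Notation Tp := (pos TT).
Local Notation Tm := (neg TT).

Definition thick := thick_tree Tp /\ thick_tree Tm.
Definition locally_finite := locally_finite_tree Tp /\ locally_finite_tree Tm.

Definition opposite (x : Tp) (y : Tm) := codist x y = 0%N.

Definition twin_auts : set (aut Tp * aut Tm) :=
  [set u : aut Tp * aut Tm | forall x y, codist (u.1 x) (u.2 y) = codist x y].

Definition type_interchanging (u : aut Tp * aut Tm) :=
  (forall x, ~~ same_type x (u.1 x)) /\ (forall y, ~~ same_type y (u.2 y)).

Definition twin_apartment (L : set Tp * set Tm) :=
  [/\ geodesic_line L.1, geodesic_line L.2,
      forall x, L.1 x -> exists! y, L.2 y /\ opposite x y &
      forall y, L.2 y -> exists! x, L.1 x /\ opposite x y].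

Definition numbering (L : set Tp * set Tm) (vp : int -> Tp) (vm : int -> Tm) :=
  [/\ injective vp /\ range vp = L.1,
      injective vm /\ range vm = L.2,
      forall j : int, adj (vp j) (vp (j + 1)%R) /\ adj (vm j) (vm (j + 1)%R) &
      forall j : int, opposite (vp j) (vm j)].

(* The boundary vertices are determined by the two half-lines (they are their
   end points), so equality of twin_root's is equality of vertex sets. *)
Record twin_root := TwinRoot {
  root_pos : set Tp;
  root_neg : set Tm;
  bd_pos : Tp;
  bd_neg : Tm
}.

Definition twin_root_of (L : set Tp * set Tm) (a : twin_root) :=
  exists vp vm (j : int), numbering L vp vm /\
    (a = TwinRoot [set vp i | i in [set i | (j <= i)%R]]
                  [set vm i | i in [set i | (i <= j)%R]] (vp j) (vm j) \/
     a = TwinRoot [set vp i | i in [set i | (i <= j)%R]]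
                  [set vm i | i in [set i | (j <= i)%R]] (vp j) (vm j)).

Definition prenilpotent (a b : twin_root) :=
  root_pos a `<=` root_pos b \/ root_pos b `<=` root_pos a.

(* U_a; as its elements fix the vertices of a, they fix an edge having a vertex
   in a iff they fix the other vertex of that edge *)
Definition root_fixator (a : twin_root) : set (aut Tp * aut Tm) :=
  [set u : aut Tp * aut Tm | [/\ twin_auts u,
    forall x, root_pos a x -> u.1 x = x,
    forall y, root_neg a y -> u.2 y = y,
    forall x x', root_pos a x -> x <> bd_pos a -> adj x x' -> u.1 x' = x' &
    forall y y', root_neg a y -> y <> bd_neg a -> adj y y' -> u.2 y' = y']].

Definition apartment_contains (L : set Tp * set Tm) (a : twin_root) :=
  root_pos a `<=` L.1 /\ root_neg a `<=` L.2.

Definition is_root_group (a : twin_root) :=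
  forall L L', twin_apartment L -> twin_apartment L' ->
    apartment_contains L a -> apartment_contains L' a ->
    exists2 u : aut Tp * aut Tm, root_fixator a u & (u.1 @` L.1 = L'.1 /\ u.2 @` L.2 = L'.2).

Definition moufang := exists2 L, twin_apartment L &
  forall a, twin_root_of L a -> is_root_group a.

(* root groups of all twin apartments, not only of the one given by moufang *)
Definition root_group_elements : set (aut Tp * aut Tm) :=
  [set u : aut Tp * aut Tm | exists L a, [/\ twin_apartment L, twin_root_of L a,
                           is_root_group a & root_fixator a u]].

Definition Lambda : set (aut Tp * aut Tm) := generated root_group_elements.

Definition comm_condition := forall L a b, twin_apartment L ->
  twin_root_of L a -> twin_root_of L b -> a <> b -> prenilpotent a b ->
  forall u w, root_fixator a u -> root_fixator b w -> commute u w.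

(* taken inside Aut(T_+): the image of the stabilizer of y in Lambda *)
Definition Gamma (y : Tm) : set (aut Tp) :=
  [set u.1 | u in [set u : aut Tp * aut Tm | Lambda u /\ u.2 y = y]].

End TwinTreeNotions.

(* Main.v *)
(** Commensurability of subgroups is handled through coverings by finitely many
left cosets.  As [Lambda] stabilizes [y] transitively on the vertices opposite
[y] and an automorphism of the twin tree fixing two opposite vertices [z], [y]
and the ball of radius 2 about [z] is trivial, [Gamma y] is commensurable with
the full stabilizer [K] of [y] in the automorphism group of the twin tree; up to
commensurability [K] does not depend on [y].

It is enough to find, for a finite subtree [F], a vertex [z] of [F] and two
neighbours [w], [w'] of [z] outside [F], an element of the commensurator that
fixes [F] and maps [w] to [w'].  Choose [y] opposite [z] and [s] in [K] with
[s z = z] and [s w = w'].  As [K] is residually finite with finite vertex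
stabilizers, a subgroup [D] of finite index in [K] has no nontrivial element
sending [z] into [F].  Define [h] to be the identity near [F] and, along any
path from [z], change it by [u s u^-1] each time the edge from [u z] to [u w] is
crossed and by [u s^-1 u^-1] for [u w'], with [u] in [D].  So [h p = c(p) p] for
a [D]-equivariant cocycle [c] with values in [K], whence
[h u h^-1 = c(u z) u], an element of [K], for all [u] in [D].  As [h] preserves
the codistance to [y], the group [h D h^-1] has finitely many orbits on the
vertices opposite [y], so it has finite index in [K]. *)
Require Import Defs.
From mathcomp Require Import all_boot all_order all_algebra.
From mathcomp Require Import all_classical topology.
From mathcomp Require Import zify.
Set Implicit Arguments.
Unset Strict Implicit.
Unset Printing Implicit Defensive.
Local Open Scope classical_set_scope.
Local Open Scope group_scope.

(** * Commensurability *)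

Section Coverings.
Variable G : groupType.
Implicit Types (H K M : set G) (g : G).

(** Allowing representatives outside [K] and sets [H] not contained in [K] makes this relation
    transitive and compatible with conjugation for arbitrary sets. *)
Definition finitely_covers H K :=
  exists2 C : set G, finite_set C & forall k, K k -> exists2 c, C c & H (c^-1 * k).

Definition commensurable H K := finitely_covers H K /\ finitely_covers K H.

Lemma sub_finitely_covers H K : K `<=` H -> finitely_covers H K.
Proof.
move=> KH; exists [set 1]; first exact: finite_set1.
by move=> k /KH Hk; exists 1 => //; rewrite invg1 mul1g.
Qed.

Lemma finitely_covers_trans H K M :
  finitely_covers H K -> finitely_covers K M -> finitely_covers H M.
Proof.
move=> [C finC CK] [D finD DM]; exists [set d * c | d in D & c in C].
  exact: finite_image2.
move=> m /DM[d Dd /CK[c Cc Hc]]; exists (d * c); first by exists d => //; exists c.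
by rewrite invgM -mulgA.
Qed.

Lemma finitely_covers_conj g H K :
  finitely_covers H K -> finitely_covers (conj_by g H) (conj_by g K).
Proof.
move=> [C finC CK]; exists [set g * c * g^-1 | c in C]; first exact: finite_image.
move=> _ [k /CK[c Cc Hk] <-]; exists (g * c * g^-1); first by exists c.
by exists (c^-1 * k) => //; rewrite !invgM invgK !mulgA mulgVK.
Qed.

(** Each fibre of [f] on [K] lies in one left coset of [H], so one chosen element per fibre
    suffices. For [f u = u p] this is the orbit-stabilizer bound. *)
Lemma finitely_covers_of_fun (X : choiceType) (f : G -> X) H K :
  finite_set (f @` K) -> (forall u v, K u -> K v -> f u = f v -> H (u^-1 * v)) ->
  finitely_covers H K.
Proof.
move=> finf fH; exists [set xget 1 [set u | K u /\ f u = x] | x in f @` K].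
  exact: finite_image.
move=> k Kk; have kk : [set u | K u /\ f u = f k] k by [].
have [Kc fc] := xgetI 1 kk.
exists (xget 1 [set u | K u /\ f u = f k]); last exact: fH.
by exists (f k) => //; exists k.
Qed.

Lemma finitely_coversI H K : is_subgroup H -> is_subgroup K ->
  finitely_covers H K -> finitely_covers (H `&` K) K.
Proof.
move=> [H1 HM HV] [K1 KM KV] [C finC CK].
(* Elements of [K] labelled by the same representative differ by an element of [H] and of [K];
   outside [K] the label is arbitrary. *)
have choose_c k : exists c, K k -> C c /\ H (c^-1 * k).
  case: (pselect (K k)) => [/CK[c Cc Hc]|nK]; first by exists c.
  by exists 1.
have [f fP] := choice choose_c.
apply: (@finitely_covers_of_fun G f).
  by apply: sub_finite_set finC => _ [k /fP[? _] <-].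
move=> u v Ku Kv fuv; split; last by apply: KM => //; exact: KV.
have [_ Hu] := fP u Ku; have [_ Hv] := fP v Kv.
have := HM _ _ (HV _ Hu) Hv.
by rewrite -fuv invgM invgK !mulgA mulgK.
Qed.

Lemma finite_index_of_covers H K :
  is_subgroup H -> finitely_covers H K -> finite_index H K.
Proof.
move=> [H1 HM HV] [C finC CK].
apply: (@sub_finite_set _ _ [set [set c * h | h in H] | c in C]); last exact: finite_image.
move=> _ [k /CK[c Cc Hc] <-]; exists c => //; apply/seteqP; split=> _ [h Hh <-].
  exists (k^-1 * c * h); last by rewrite -!mulgA mulVKg.
  by apply: HM => //; rewrite -[k^-1 * c]invgK invgM invgK; exact: HV.
exists (c^-1 * k * h); last by rewrite -!mulgA mulVKg.
exact: HM.
Qed.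

Lemma is_subgroup_conj g H : is_subgroup H -> is_subgroup (conj_by g H).
Proof.
move=> [H1 HM HV]; split.
- by exists 1 => //; rewrite mulg1 mulgV.
- move=> _ _ [h Hh <-] [k Hk <-]; exists (h * k); first exact: HM.
  by rewrite !mulgA mulgVK.
- by move=> _ [h Hh <-]; exists h^-1; [exact: HV|rewrite !invgM invgK mulgA].
Qed.

Lemma is_subgroupI H K : is_subgroup H -> is_subgroup K -> is_subgroup (H `&` K).
Proof.
move=> [H1 HM HV] [K1 KM KV]; split=> //.
  by move=> x y [? ?] [? ?]; split; [exact: HM|exact: KM].
by move=> x [? ?]; split; [exact: HV|exact: KV].
Qed.

Lemma commensurable_sym H K : commensurable H K -> commensurable K H.
Proof. by case. Qed.

Lemma commensurable_trans H K M :
  commensurable H K -> commensurable K M -> commensurable H M.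
Proof.
by move=> [HK KH] [KM MK]; split;
  [exact: finitely_covers_trans HK KM|exact: finitely_covers_trans MK KH].
Qed.

Lemma commensurable_conj g H K :
  commensurable H K -> commensurable (conj_by g H) (conj_by g K).
Proof. by case=> HK KH; split; exact: finitely_covers_conj. Qed.

Lemma conj_byM g h H : conj_by (g * h) H = conj_by g (conj_by h H).
Proof.
apply/seteqP; split=> [_ [k Hk <-]|_ [_ [k Hk <-] <-]].
  by exists (h * k * h^-1); [exists k|rewrite invgM !mulgA].
by exists k => //; rewrite invgM !mulgA.
Qed.

Lemma conj_by1 H : conj_by 1 H = H.
Proof.
apply/seteqP; split=> [_ [k Hk <-]|k Hk]; first by rewrite mul1g invg1 mulg1.
by exists k => //; rewrite mul1g invg1 mulg1.
Qed.

(** In this form the condition is closed under products and depends only on the commensurability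
    class of [H]; [commensuratorP] returns to finite indices. *)
Definition commensurates H g := commensurable H (conj_by g H).

Lemma commensurates1 H : commensurates H 1.
Proof. by rewrite /commensurates conj_by1; split; exact: sub_finitely_covers. Qed.

Lemma commensuratesM H g h :
  commensurates H g -> commensurates H h -> commensurates H (g * h).
Proof.
move=> Hg Hh; rewrite /commensurates conj_byM.
exact: commensurable_trans Hg (commensurable_conj _ Hh).
Qed.

Lemma commensurates_commensurable H K g :
  commensurable H K -> commensurates H g -> commensurates K g.
Proof.
move=> HK Hg; apply: commensurable_trans (commensurable_sym HK) _.
exact: commensurable_trans Hg (commensurable_conj _ HK).
Qed.

Lemma commensuratorP H g : is_subgroup H -> commensurates H g -> commensurator H g.
Proof.
move=> sH [HC CH]; have sC := is_subgroup_conj g sH; have sI := is_subgroupI sH sC.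
split; apply: finite_index_of_covers => //; last exact: finitely_coversI.
by rewrite setIC; exact: finitely_coversI.
Qed.

End Coverings.

Lemma finitely_covers_image (G G' : groupType) (f : G -> G') (H K : set G) :
  (forall u v, f (u^-1 * v) = (f u)^-1 * f v) ->
  finitely_covers H K -> finitely_covers (f @` H) (f @` K).
Proof.
move=> fM [C finC CK]; exists (f @` C); first exact: finite_image.
move=> _ [k /CK[c Cc Hc] <-]; exists (f c); first by exists c.
by rewrite -fM; exists (c^-1 * k).
Qed.

(** * Trees and codistances *)

Section TreeDistance.
Variable T : tree.
Implicit Types x y z : T.

Lemma dist_le_size x p : path adj x p -> (dist x (last x p) <= size p)%N.
Proof. by move=> px; have [_ min] := (distP x (last x p) _).1 erefl; exact: min. Qed.

Lemma geodesic_path x y : exists p, [/\ path adj x p, last x p = y & size p = dist x y].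
Proof. by have [? _] := (distP x y _).1 erefl. Qed.

Lemma distxx x : dist x x = 0%N.
Proof. by apply/eqP; rewrite -leqn0; exact: (@dist_le_size x [::]). Qed.

Lemma dist0 x y : dist x y = 0%N -> x = y.
Proof. by have [p [_ <- sp]] := geodesic_path x y => d0; case: p sp d0 => //= ? ? <-. Qed.

Lemma dist_triangle y x z : (dist x z <= dist x y + dist y z)%N.
Proof.
have [p [pp <- <-]] := geodesic_path x y; have [q [qq <- <-]] := geodesic_path (last x p) z.
by rewrite -last_cat -size_cat; apply: dist_le_size; rewrite cat_path pp.
Qed.

Lemma adj_dist x y : adj x y -> dist x y = 1%N.
Proof.
move=> xy; have le1 : (dist x y <= 1)%N by apply: (@dist_le_size x [:: y]); rewrite /= xy.
case E : (dist x y) le1 => [|[|n]] // _.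
by move: xy; rewrite (dist0 E) adj_irr.
Qed.

Lemma dist1_adj x y : dist x y = 1%N -> adj x y.
Proof.
by have [[|a [|b p]] [pp <- <-]] := geodesic_path x y => // _; case/andP: pp.
Qed.

Lemma adj_neq x y : adj x y -> x <> y.
Proof. by move=> xy E; move: xy; rewrite E adj_irr. Qed.

Lemma dist_step x y n : dist x y = n.+1 -> exists2 x', adj x x' & dist x' y = n.
Proof.
move=> E; have [[|a p] []] := geodesic_path x y; rewrite E //= => /andP[xa pa] la [sp].
exists a => //; have := dist_le_size pa; rewrite la sp => le.
have := dist_triangle a x y; rewrite E (adj_dist xa) add1n ltnS => ge.
by apply/eqP; rewrite eqn_leq le.
Qed.

Lemma dist_sym x y : dist x y = dist y x.
Proof.
suff le (a b : T) : (dist a b <= dist b a)%N by apply/eqP; rewrite eqn_leq !le.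
elim: {b}(dist b a) {-2}b (erefl (dist b a)) => [b /dist0->|n IH b E]; first by rewrite distxx.
have [b' bb' D] := dist_step E.
have := IH b' D; have := dist_triangle b' a b; rewrite adj_sym in bb'.
by rewrite (adj_dist bb'); lia.
Qed.

Lemma tree_ind x0 (P : T -> Prop) :
  P x0 -> (forall x y, P x -> adj x y -> P y) -> forall x, P x.
Proof.
move=> P0 Pstep x; have [p [+ <-]] := tree_connected x0 x.
by elim: p x0 P0 => //= a p IH x0 P0 /andP[x0a]; apply: IH; exact: Pstep x0a.
Qed.

Lemma thick_avoid x a b : thick_tree T -> exists c, [/\ adj x c, c <> a & c <> b].
Proof.
move=> /(_ x) thx; apply: contrapT => no.
have sub : nbrs x `<=` [set if i is 0%N then a else b | i in `I_2].
  move=> c xc; have [<-|ca] := pselect (a = c); first by exists 0%N.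
  have [<-|cb] := pselect (b = c); first by exists 1%N.
  by case: no; exists c; split=> //; exact: nesym.
have := card_le_trans thx (card_le_trans (subset_card_le sub) (card_image_le _ _)).
by rewrite card_le_II.
Qed.

End TreeDistance.

Section Codistance.
Variables (T T' : tree) (d : T -> T' -> nat).
Hypothesis dT' : codistance_axiom d.
Hypothesis dT : codistance_axiom (fun y x => d x y).
Implicit Types (x : T) (y : T').

Lemma codist_adj x y y' : adj y y' -> d x y' = (d x y).+1 \/ (d x y').+1 = d x y.
Proof. by case: (dT' x y) => + _; exact. Qed.

Lemma codist_up x y : (0 < d x y)%N -> exists2 y', adj y y' & d x y' = (d x y).+1.
Proof. by case: (dT' x y) => _ /[apply] -[y' [[? ?] _]]; exists y'. Qed.

Lemma codist_up_uniq x y y1 y2 : (0 < d x y)%N -> adj y y1 -> adj y y2 ->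
  d x y1 = (d x y).+1 -> d x y2 = (d x y).+1 -> y1 = y2.
Proof.
case: (dT' x y) => _ /[apply] -[y' [_ un]] yy1 yy2 d1 d2.
by rewrite -(un y1 (conj yy1 d1)); exact: un.
Qed.

Lemma codist_opp x y y' : adj y y' -> d x y = 0%N -> d x y' = 1%N.
Proof. by move=> /(codist_adj x) + d0; rewrite d0 => -[->|]. Qed.

Lemma codist_down x y y1 y2 : (0 < d x y)%N -> adj y y1 -> adj y y2 ->
  d x y1 = (d x y).+1 -> y2 <> y1 -> (d x y2).+1 = d x y.
Proof.
move=> d0 yy1 yy2 d1 ne; case: (codist_adj x yy2) => // d2.
by case: ne; exact: codist_up_uniq d2 d1.
Qed.

Lemma codist_dist x y y' : (d x y <= d x y' + dist y y')%N.
Proof.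
elim: {y}(dist y y') {-2}y (erefl (dist y y')) => [y /dist0-> |n IH y E]; first lia.
by have [y1 yy1 D] := dist_step E; have := IH _ D; case: (codist_adj x yy1); lia.
Qed.

(* Once a geodesic has gone down, the unique ascending neighbour of each of its
   vertices is the preceding one. *)
Lemma codist_descent n x y y1 z : adj y y1 -> dist y1 z = n -> dist y z = n.+1 ->
  (d x y1).+1 = d x y -> (n <= d x y1)%N -> (d x z + n)%N = d x y1.
Proof.
elim: n y y1 => [|n IH] y y1 yy1 D1 D0 down le; first by rewrite (dist0 D1) addn0.
have [y2 y12 D2] := dist_step D1.
have ne : y2 <> y by move=> E; rewrite E D0 in D2; lia.
have down2 : (d x y2).+1 = d x y1.
  have y1y : adj y1 y by rewrite adj_sym.
  by apply: (codist_down _ y1y y12 _ ne); lia.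
by have := IH _ _ y12 D2 D1 down2; lia.
Qed.

(** At positive codistance only one neighbour ascends, so thickness always leaves a descending
    step. *)
Lemma exists_opposite x : thick_tree T' -> exists y, d x y = 0%N.
Proof.
move=> th; have [y _] := tree_nonempty T'.
elim: {y}(d x y) {-2}y (erefl (d x y)) => [y d0|n IH y E]; first by exists y.
have [|y1 yy1 d1] := @codist_up x y; first by rewrite E.
have [y2 [yy2 ne _]] := thick_avoid y y1 y1 th.
by apply: (IH y2); have := codist_down _ yy1 yy2 d1 ne; rewrite E => /(_ isT)[].
Qed.

(** For [k = 0], leave a vertex opposite [x] in a direction that does not ascend relative to [x1].
    To raise [k], follow the ascending neighbour relative to [x]; the codistance to the adjacent
    vertex [x1] is then forced to rise too. *)
Lemma exists_codist k x x1 : thick_tree T' -> adj x x1 ->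
  exists y, d x y = k.+1 /\ d x1 y = k.
Proof.
move=> th xx1; elim: k => [|k [y [dx dx1]]].
  have [y0 d0] := exists_opposite x th.
  have d1 : d x1 y0 = 1%N by case: (dT y0 x) => /(_ x1 xx1) + _; rewrite d0; lia.
  have [|y1 yy1] := @codist_up x1 y0; first by rewrite d1.
  rewrite d1 => up; have [y2 [yy2 ne _]] := thick_avoid y0 y1 y1 th.
  exists y2; split; first exact: codist_opp yy2 d0.
  have := @codist_down x1 _ _ _ _ yy1 yy2 _ ne.
  by rewrite d1 => /(_ isT up) [].
have [|y1 yy1] := @codist_up x y; first by rewrite dx.
rewrite dx => up; exists y1; split=> //.
have := codist_adj x1 yy1; rewrite dx1.
by case: (dT y1 x) => /(_ x1 xx1) + _; rewrite up; lia.
Qed.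

End Codistance.

Section TwinTreeGeometry.
Variables (T T' : tree) (d : T -> T' -> nat).
Hypothesis dT' : codistance_axiom d.
Hypothesis dT : codistance_axiom (fun y x => d x y).
Hypothesis thT' : thick_tree T'.
Implicit Types (x : T) (y : T').

(** If [x] and [x'] are [n.+1] apart, choose [y] at codistance [n.+1] from [x] such that the first
    step towards [x'] descends. The descent continues down to codistance 0 at [x']. *)
Lemma codist_separates x x' : (forall y, d x y = d x' y) -> x = x'.
Proof.
move=> same; case E : (dist x x') => [|n]; first exact: dist0.
have [x1 xx1 D1] := dist_step E.
have [y [dx dx1]] := exists_codist dT' dT n thT' xx1.
have := codist_descent dT xx1 D1 E; move=> /(_ y); rewrite dx dx1 -same dx => /(_ erefl (leqnn _)).
lia.
Qed.

(* If the path to [z] through [x1] descends and [x2] is the ascending neighbour of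
   [x] relative to [y], then [d z y] is too small for [z] to be close to [x2]. *)
Lemma closer_uniq x x1 x2 z : adj x x1 -> adj x x2 ->
  (dist x1 z < dist x z)%N -> (dist x2 z < dist x z)%N -> x1 = x2.
Proof.
move=> xx1 xx2 lt1 lt2; apply: contrapT => ne.
case E : (dist x z) lt1 lt2 => [|n] // lt1 lt2.
have D1 : dist x1 z = n.
  by have := dist_triangle x1 x z; rewrite (adj_dist xx1) E; lia.
have x2x : adj x2 x by rewrite adj_sym.
have [y [d2 dx]] := exists_codist dT' dT n.+1 thT' x2x.
have d1 : (d x1 y).+1 = d x y.
  by apply: (codist_down dT _ xx2 xx1 _ ne); rewrite ?dx ?d2.
have := codist_descent dT xx1 D1 E d1; have := codist_dist dT y x2 z; move: d1 d2 lt2.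
by rewrite dx; lia.
Qed.

(** Codistance to a fixed [y] changes parity along every edge, so it gives a two-colouring of the
    tree. *)
Lemma codist_odd x x' y : odd (dist x x') = odd (d x y) (+) odd (d x' y).
Proof.
elim: {x}(dist x x') {-2}x (erefl (dist x x')) => [x /dist0->|n IH x E].
  by rewrite distxx addbb.
have [x1 xx1 D] := dist_step E; rewrite E /= -D (IH _ D).
by case: (codist_adj dT y xx1) => [->|<-] /=; rewrite ?negbK ?addNb ?negbK.
Qed.

Lemma adj_dist_cases x x1 z : adj x x1 ->
  dist x z = (dist x1 z).+1 \/ dist x1 z = (dist x z).+1.
Proof.
move=> xx1; have x1x : adj x1 x by rewrite adj_sym.
have [y _] := tree_nonempty T'.
have := codist_odd x z y; have := codist_odd x1 z y.
have := dist_triangle x1 x z; have := dist_triangle x x1 z.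
rewrite (adj_dist xx1) (adj_dist x1x).
by case: (codist_adj dT y xx1) => [->|<-] /=; lia.
Qed.

End TwinTreeGeometry.

(** * Rigidity of twin automorphisms *)

Lemma finite_sphere (T : tree) (x : T) n :
  locally_finite_tree T -> finite_set [set y | dist y x = n].
Proof.
move=> lf; elim: n => [|n IH].
  by apply: sub_finite_set (finite_set1 x) => y /dist0.
apply: (@sub_finite_set _ _ (\bigcup_(y in [set y | dist y x = n]) nbrs y)).
  by move=> y /= /dist_step[y' yy' D]; exists y' => //; rewrite /nbrs /= adj_sym.
exact: bigcup_finite.
Qed.

Lemma aut_dist (T : tree) (g : aut T) x y : dist (g x) (g y) = dist x y.
Proof.
suff le (h : aut T) a b : (dist (h a) (h b) <= dist a b)%N.
  by apply/eqP; rewrite eqn_leq le -{1}[x](aut_funK g) -{1}[y](aut_funK g) (le g^-1).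
have [p [pp <- <-]] := geodesic_path a b.
rewrite -last_map -(size_map h); apply: dist_le_size.
by rewrite path_map; apply: sub_path pp => u v; rewrite /= aut_adj.
Qed.

Lemma aut_injective (T : tree) (g : aut T) : injective g.
Proof. exact: can_inj (aut_funK g). Qed.

Section PointwiseFixator.
Variables (T : tree) (G : groupType) (f : G -> aut T).
Hypothesis fM : forall u v, f (u * v) = f u * f v.
Hypothesis fV : forall u, f u^-1 = (f u)^-1.
Variables (K : set G) (x0 : T).
Hypotheses (lf : locally_finite_tree T) (sK : is_subgroup K).
Hypothesis Kx0 : forall u, K u -> f u x0 = x0.

(** As [K] fixes [x0], each orbit lies in a finite sphere about [x0], so each further vertex costs
    only a finite index. The homomorphism [f] stands for either projection of a pair of
    automorphisms. *)
Lemma fixator_covers (s : seq T) :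
  finitely_covers [set u | K u /\ forall p, p \in s -> f u p = p] K.
Proof.
have [K1 KM KV] := sK.
elim: s => [|a s IH]; first by apply: sub_finitely_covers => u Ku.
apply: finitely_covers_trans IH; apply: (@finitely_covers_of_fun _ _ (fun u => f u a)).
  apply: sub_finite_set (finite_sphere x0 (dist a x0) lf) => _ [u [Ku _] <-] /=.
  by rewrite -{1}(Kx0 Ku) aut_dist.
move=> u v [Ku us] [Kv vs] uv; split; first by apply: KM => //; exact: KV.
move=> p; rewrite inE fM fV autM autV => /orP[/eqP->|ps]; first by rewrite -uv aut_funK.
by rewrite vs // -{1}(us p ps) aut_funK.
Qed.

End PointwiseFixator.

Section Rigidity.
Variables (T T' : tree) (d : T -> T' -> nat).
Hypothesis dT' : codistance_axiom d.
Hypothesis dT : codistance_axiom (fun y x => d x y).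
Variables (g : aut T) (g' : aut T').
Hypothesis gd : forall x y, d (g x) (g' y) = d x y.

Definition fixes_star (S : tree) (h : aut S) x := h x = x /\ forall x', adj x x' -> h x' = x'.

(** Each neighbour [y'] of [y] determines a neighbour [x'] of [x] at codistance 2 from it, and [y']
    is the unique ascending neighbour of [y] relative to [x']. Fixing [y] and [x'] therefore fixes
    [y']. *)
Lemma fixes_star_opposite x y :
  d x y = 0%N -> g' y = y -> fixes_star g x -> fixes_star g' y.
Proof.
move=> opp gy [gx fx]; split=> // y' yy'.
have d1 : d x y' = 1%N by apply: codist_opp opp.
have [|x' xx'] := codist_up dT (x := y') (y := x); first by rewrite d1.
rewrite d1 => d2; have yx' := codist_opp dT xx' opp.
apply: (codist_up_uniq (d := d) dT' (x := x') (y := y)); rewrite ?yx' //.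
  by rewrite -{1}gy aut_adj.
by rewrite -{1}(fx x' xx') gd.
Qed.

End Rigidity.

Section RigidityTwin.
Variable TT : twin_tree.
Hypothesis hthick : thick TT.
Local Notation Tp := (pos TT).
Local Notation Tm := (neg TT).

Let cp := @codist_pos TT.
Let cm := @codist_neg TT.

Variable u : aut Tp * aut Tm.
Hypothesis uA : twin_auts u.

Let star_lr x y : codist x y = 0%N -> u.2 y = y -> fixes_star u.1 x -> fixes_star u.2 y.
Proof. exact: (fixes_star_opposite cp cm uA). Qed.

Let star_rl x y : codist x y = 0%N -> u.1 x = x -> fixes_star u.2 y -> fixes_star u.1 x.
Proof.
exact: (fixes_star_opposite (d := fun y x => codist x y) cm cp (fun y x => uA x y)).
Qed.

(** The invariant carried from edge to edge in the rigidity proof: an edge with an opposite edge,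
    all four stars being fixed. *)
Definition fixed_opposite_edges (x x1 : Tp) := exists y y1 : Tm,
  [/\ adj y y1, codist x y = 0%N, codist x1 y1 = 0%N, fixes_star u.1 x /\ fixes_star u.1 x1 &
      fixes_star u.2 y /\ fixes_star u.2 y1].

Lemma fixed_opposite_edges_step x x1 x2 : adj x x1 -> adj x x2 ->
  fixed_opposite_edges x x1 -> fixed_opposite_edges x x2.
Proof.
have [thp thm] := hthick.
move=> xx1 xx2 [y [y1 [yy1 oxy ox1y1 [sx sx1] [sy sy1]]]].
have y1y : adj y1 y by rewrite adj_sym.
have dxy1 : codist x y1 = 1%N by apply: codist_opp oxy.
have good a : adj x a -> codist a y1 = 0%N -> fixes_star u.1 a.
  by move=> xa oa; apply: (star_rl oa) sy1; apply: sx.2.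
(* If [x2] is opposite [y1], the edge from [y] to [y1] serves again. *)
case E : (codist x2 y1) => [|n].
  by exists y, y1; split=> //; split=> //; exact: good.
have {E n} d2 : codist x2 y1 = 2%N.
  by case: (codist_adj cm y1 xx2); rewrite dxy1 E //; case.
have dx2y : codist x2 y = 1%N by exact: (codist_opp cm xx2 oxy).
have [y2 [yy2 ne _]] := thick_avoid y y1 y1 thm.
have ox2y2 : codist x2 y2 = 0%N.
  by have := @codist_down _ _ _ cp x2 y y1 y2; rewrite dx2y d2 => /(_ isT yy1 yy2 erefl ne) [].
have dxy2 : codist x y2 = 1%N by apply: codist_opp oxy.
have [|x3 xx3] := codist_up cm (x := y2) (y := x); first by rewrite dxy2.
(* Avoiding the ascending neighbours [x2] (for [y1]) and [x3] (for [y2]) gives [x4] opposite both.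
   Fixed stars then pass from [y1] to [x4], to [y2], and to [x2]. *)
rewrite dxy2 => d3; have [x4 [xx4 ne42 ne43]] := thick_avoid x x2 x3 thp.
have o4 : codist x4 y2 = 0%N.
  have := @codist_down _ _ _ cm y2 x x3 x4; rewrite dxy2 d3.
  by move=> /(_ isT xx3 xx4 erefl ne43) [].
have o41 : codist x4 y1 = 0%N.
  have := @codist_down _ _ _ cm y1 x x2 x4; rewrite dxy1 d2.
  by move=> /(_ isT xx2 xx4 erefl ne42) [].
have sy2 : fixes_star u.2 y2.
  by apply: (star_lr o4); [apply: sy.2|exact: good].
exists y, y2; split=> //; split=> //.
by apply: (star_rl ox2y2) sy2; apply: sx.2.
Qed.

Lemma fixed_opposite_edges_sym x x1 :
  fixed_opposite_edges x x1 -> fixed_opposite_edges x1 x.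
Proof. by case=> y [y1 [yy1 ? ? [? ?] [? ?]]]; exists y1, y; split=> //; rewrite adj_sym. Qed.

(** The ball of radius 2 contains the stars of [z] and of a neighbour, which start the propagation
    of [fixed_opposite_edges]. Once [u.1] is trivial, codistances determine [u.2]. *)
Lemma twin_aut_rigid z y : codist z y = 0%N -> u.2 y = y ->
  (forall x, (dist x z <= 2)%N -> u.1 x = x) -> u = 1.
Proof.
have [thp thm] := hthick.
move=> opp uy uz.
have [x1 [zx1 _ _]] := thick_avoid z z z thp.
have sz : fixes_star u.1 z.
  split=> [|x zx]; apply: uz; first by rewrite distxx.
  by rewrite dist_sym (adj_dist zx).
have sx1 : fixes_star u.1 x1.
  split=> [|x x1x]; apply: uz; first by rewrite dist_sym (adj_dist zx1).
  by have := dist_triangle x1 z x; rewrite dist_sym (adj_dist zx1) (adj_dist x1x).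
have sy := star_lr opp uy sz.
have d1 : codist x1 y = 1%N by exact: (codist_opp cm zx1 opp).
have [|y0 yy0] := codist_up cp (x := x1) (y := y); first by rewrite d1.
rewrite d1 => d2; have [y1 [yy1 ne _]] := thick_avoid y y0 y0 thm.
have o1 : codist x1 y1 = 0%N.
  by have := @codist_down _ _ _ cp x1 y y0 y1; rewrite d1 d2 => /(_ isT yy0 yy1 erefl ne) [].
have sy1 := star_lr o1 (sy.2 _ yy1) sx1.
have fix1 x : exists2 x1, adj x x1 & fixed_opposite_edges x x1.
  elim/(@tree_ind Tp z): x => [|x x' [x2 xx2 F] xx'].
    by exists x1 => //; exists y, y1.
  exists x; first by rewrite adj_sym.
  exact: fixed_opposite_edges_sym (fixed_opposite_edges_step xx2 xx' F).
have u1 x : u.1 x = x by have [? _ [? [? [_ _ _ [[-> _] _] _]]]] := fix1 x.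
have u2 q : u.2 q = q.
  apply: (codist_separates cm cp thp) => x.
  by rewrite -{1}(u1 x) uA.
by rewrite [u]surjective_pairing; congr (_, _); exact: autP.
Qed.

End RigidityTwin.

(** * Finiteness of the stabilizers of opposite pairs *)

Section Stabilizers.
Variable TT : twin_tree.
Hypotheses (hthick : thick TT) (hlf : locally_finite TT).
Local Notation Tp := (pos TT).
Local Notation Tm := (neg TT).

Lemma is_subgroup_twin_auts : is_subgroup (@twin_auts TT).
Proof.
split=> //; first by move=> u v uA vA x y; rewrite /= uA vA.
by move=> u uA x y; rewrite -[in RHS](aut_invK u.1 x) -[in RHS](aut_invK u.2 y) uA.
Qed.

Definition stab (H : set (aut Tp * aut Tm)) (y : Tm) := [set u | H u /\ u.2 y = y].

Lemma is_subgroup_stab H y : is_subgroup H -> is_subgroup (stab H y).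
Proof.
move=> [H1 HM HV]; split=> //.
  by move=> u v [Hu uy] [Hv vy]; split; [exact: HM|rewrite /= vy].
by move=> u [Hu uy]; split; [exact: HV|rewrite /= -{1}uy aut_funK].
Qed.

Lemma finite_stab (z : Tp) (y : Tm) : opposite z y ->
  finite_set [set u | stab (@twin_auts TT) y u /\ u.1 z = z].
Proof.
move=> opp; pose K := [set u | stab (@twin_auts TT) y u /\ u.1 z = z].
have [S1 SM SV] := is_subgroup_stab y is_subgroup_twin_auts.
have sK : is_subgroup K.
  split=> //.
    by move=> u v [Hu uy] [Hv vy]; split; [exact: SM|rewrite /= vy].
  by move=> u [Hu uy]; split; [exact: SV|rewrite /= -{1}uy aut_funK].
(* Distances 0, 1 and 2: the ball whose pointwise fixator is trivial by [twin_aut_rigid]. Finitely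
   many cosets of the trivial group then exhaust [K]. *)
have finB : finite_set (\bigcup_(n in `I_3) [set x : Tp | dist x z = n]).
  by apply: bigcup_finite => [|n _]; [exact: finite_II|exact: finite_sphere hlf.1].
have [s sE] := (finite_seqP _).1 finB.
have Kz u : K u -> u.1 z = z by case.
have [C finC CK] := @fixator_covers Tp _ fst (fun _ _ => erefl) (fun _ => erefl) K z hlf.1 sK Kz s.
apply: sub_finite_set finC => u /CK[c Cc [Ku fu]].
suff E : c^-1 * u = 1 by rewrite -[u](mulVKg c) E mulg1.
apply: (twin_aut_rigid hthick Ku.1.1 opp Ku.1.2) => x le.
apply: fu; have : [set` s] x by rewrite -sE; exists (dist x z).
by [].
Qed.

End Stabilizers.

(** * Twin apartments *)

Section AscendingRays.
Variables (T T' : tree) (d : T -> T' -> nat).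
Hypothesis dT : codistance_axiom (fun y x => d x y).

Lemma exists_up_ray x x' y : adj x x' -> d x y = 0%N ->
  exists X : nat -> T, [/\ X 0%N = x, X 1%N = x', forall n, adj (X n) (X n.+1) &
                           forall n, d (X n) y = n].
Proof.
move=> xx' d0.
(* At codistance 0 the chosen successor is arbitrary, so the iteration starts at [x']. *)
have up a : exists a', (0 < d a y)%N -> adj a a' /\ d a' y = (d a y).+1.
  have [/(codist_up dT)[a' aa' da']|] := ltnP 0 (d a y); first by exists a'.
  by exists a.
have [f fP] := choice up.
have dX n : d (iter n f x') y = n.+1.
  elim: n => [|n IH] /=; first exact: (codist_opp dT xx' d0).
  by have [|_ ->] := fP (iter n f x'); rewrite IH.
exists (fun n => if n is m.+1 then iter m f x' else x); split=> //; last by case.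
by case=> [|n] //; have [|] := fP (iter n f x'); rewrite ?dX.
Qed.

End AscendingRays.

Section TwinLines.
Variables (T T' : tree) (d : T -> T' -> nat).
Hypothesis dT' : codistance_axiom d.
Hypothesis dT : codistance_axiom (fun y x => d x y).
Implicit Types (x : T) (y : T') (i j k : int) (n m : nat).

(** The first descent along a geodesic ray would continue, by [codist_descent], to a second vertex
    opposite [y]. *)
Lemma ray_codist (b : nat -> T) y :
  (forall n m, dist (b n) (b (n + m)%N) = m) -> d (b 0%N) y = 0%N ->
  (forall n, d (b n.+1) y <> 0%N) -> forall n, d (b n) y = n.
Proof.
move=> geo d0 dn; have ba n : adj (b n) (b n.+1) by apply: dist1_adj; rewrite -addn1.
elim=> // -[|n] IH; first exact: (codist_opp dT (ba 0%N) d0).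
case: (codist_adj dT y (ba n.+1)) => [->|down]; first by rewrite IH.
have D1 : dist (b n.+2) (b (n.+2 + n)%N) = n by [].
have D0 : dist (b n.+1) (b (n.+2 + n)%N) = n.+1.
  by rewrite (_ : (n.+2 + n)%N = (n.+1 + n.+1)%N) //; lia.
have := codist_descent dT (ba n.+1) D1 D0 down.
move: down; rewrite IH => -[->] /(_ (leqnn _)) E; case: (dn (n.+1 + n)%N).
rewrite -addSn; lia.
Qed.

Lemma line_codist (v : int -> T) y i0 : geodesic v -> d (v i0) y = 0%N ->
  (forall i, d (v i) y = 0%N -> i = i0) -> forall i, d (v i) y = `|(i - i0)%R|%N.
Proof.
move=> geo d0 uniq i.
have right n : d (v (i0 + n%:Z)%R) y = n.
  apply: (ray_codist (b := fun n => v (i0 + n%:Z)%R)) => [n' m||n'].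
  - by rewrite geo; lia.
  - by rewrite GRing.addr0.
  - by move=> /uniq; lia.
have left n : d (v (i0 - n%:Z)%R) y = n.
  apply: (ray_codist (b := fun n => v (i0 - n%:Z)%R)) => [n' m||n'].
  - by rewrite geo; lia.
  - by rewrite GRing.subr0.
  - by move=> /uniq; lia.
have [le|le] : (i0 <= i)%R \/ (i <= i0)%R by lia.
  by rewrite -{1}(_ : (i0 + `|(i - i0)%R|%N%:Z)%R = i) ?right //; lia.
by rewrite -{1}(_ : (i0 - `|(i - i0)%R|%N%:Z)%R = i) ?left //; lia.
Qed.

(** A twin apartment numbered so that opposite vertices share an index; the codistance formula
    encodes both geodesics and the uniqueness of opposites. *)
Definition twin_line (vp : int -> T) (vm : int -> T') :=
  [/\ forall i, adj (vp i) (vp (i + 1)%R), forall i, adj (vm i) (vm (i + 1)%R) &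
      forall i k, d (vp i) (vm k) = `|(i - k)%R|%N].

Lemma twin_line_geodesic vp vm : twin_line vp vm -> geodesic vp.
Proof.
move=> [ap _ dv].
have le i n : (dist (vp i) (vp (i + n%:Z)%R) <= n)%N.
  elim: n => [|n IH]; first by rewrite GRing.addr0 distxx.
  have := dist_triangle (vp (i + n%:Z)%R) (vp i) (vp (i + n.+1%:Z)%R).
  have := adj_dist (ap (i + n%:Z)%R).
  by rewrite (_ : (i + n%:Z + 1)%R = (i + n.+1%:Z)%R); lia.
move=> i k; apply/eqP; rewrite eqn_leq; apply/andP; split.
  have [ik|ik] : (i <= k)%R \/ (k <= i)%R by lia.
    by have := le i `|(i - k)%R|%N; rewrite (_ : (i + _)%R = k) //; lia.
  by rewrite dist_sym; have := le k `|(i - k)%R|%N; rewrite (_ : (k + _)%R = i) //; lia.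
by have := codist_dist dT (vm k) (vp i) (vp k); rewrite !dv; lia.
Qed.

(** The ascending neighbour of [X n] relative to [Y m.+1] also ascends relative to [Y m], hence is
    [X n.+1]. At [n = m = 0] uniqueness fails, and the value 2 is a hypothesis. *)
Lemma ray_codistD (X : nat -> T) (Y : nat -> T') :
  (forall n, adj (X n) (X n.+1)) -> (forall n, adj (Y n) (Y n.+1)) ->
  (forall n, d (X n) (Y 0%N) = n) -> (forall m, d (X 0%N) (Y m) = m) ->
  d (X 1%N) (Y 1%N) = 2%N -> forall m n, d (X n) (Y m) = (n + m)%N.
Proof.
move=> aX aY dX dY d11; elim=> [n|m IHm]; first by rewrite dX addn0.
elim=> [|n IHn]; first by rewrite dY.
have [/eqP|nm] := eqVneq (n + m)%N 0%N.
  by rewrite addn_eq0 => /andP[/eqP-> /eqP->].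
have [|x xX] := codist_up dT (x := Y m.+1) (y := X n); first by rewrite IHn; lia.
rewrite IHn => dx.
have xm : d x (Y m) = (n + m).+1.
  have := codist_adj dT' x (aY m); have := codist_adj dT (Y m) xX.
  by rewrite dx IHm; lia.
suff -> : X n.+1 = x by rewrite dx; lia.
by apply: (codist_up_uniq (d := fun y x => d x y) dT _ (aX n) xX (x := Y m)); rewrite ?IHm ?xm; lia.
Qed.

(** Relative to [b m] the ray [a] ascends, so [X], which leaves in another direction, descends until
    index [m]. Exchanging the two trees gives the range [m <= n]. *)
Lemma ray_codistB (X a : nat -> T) (b Y : nat -> T') :
  (forall n, adj (X n) (X n.+1)) -> (forall n, adj (b n) (b n.+1)) ->
  adj (a 0%N) (a 1%N) -> adj (Y 0%N) (Y 1%N) -> X 0%N = a 0%N -> b 0%N = Y 0%N ->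
  (forall n m, d (X n) (Y m) = (n + m)%N) -> (forall n m, d (a n) (b m) = (n + m)%N) ->
  X 1%N <> a 1%N -> forall n m, d (X n) (b m) = `|(n%:Z - m%:Z)%R|%N.
Proof.
move=> aX ab aa aY X0 b0 dXY dab ne.
have dX n : d (X n) (b 0%N) = n by rewrite b0 dXY addn0.
have db m : d (X 0%N) (b m) = m by rewrite X0 dab.
have neb : b 1%N <> Y 1%N.
  move=> E; apply: ne; rewrite -E -b0 in aY.
  apply: (codist_up_uniq (d := fun y x => d x y) dT (x := b 1%N) (y := X 0%N)) => //.
  - by rewrite db.
  - by rewrite X0.
  - by rewrite db E dXY.
  - by rewrite db dab.
have low n m : (n <= m)%N -> d (X n) (b m) = (m - n)%N.
  elim: n {-2}n (leqnn n) => [|N IH] n; first by rewrite leqn0 => /eqP->; rewrite db subn0.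
  case: n => [_ _|[_ m1|n nN nm]]; first by rewrite db subn0.
    have := @codist_down _ _ _ dT (b m) (X 0%N) (a 1%N) (X 1%N).
    by rewrite db dab X0 => /(_ m1 aa); rewrite -X0 => /(_ (aX 0%N) erefl ne); lia.
  have E0 : d (X n) (b m) = (m - n)%N by apply: IH; lia.
  have E1 : d (X n.+1) (b m) = (m - n.+1)%N by apply: IH; lia.
  have xX : adj (X n.+1) (X n) by rewrite adj_sym.
  have ne2 : X n.+2 <> X n by move=> /(congr1 (d ^~ (b 0%N))); rewrite !dX; lia.
  by have := @codist_down _ _ _ dT (b m) _ _ _ _ xX (aX n.+1) _ ne2; rewrite E0 E1; lia.
have high m n : (m <= n)%N -> d (X n) (b m) = (n - m)%N.
  elim: m {-2}m (leqnn m) => [|N IH] m; first by rewrite leqn0 => /eqP->; rewrite dX subn0.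
  case: m => [_ _|[_ m1|m nN nm]]; first by rewrite dX subn0.
    have := @codist_down _ _ _ dT' (X n) (b 0%N) (Y 1%N) (b 1%N).
    by rewrite dX dXY b0 => /(_ m1 aY); rewrite -b0 => /(_ (ab 0%N) _ neb); lia.
  have E0 : d (X n) (b m) = (n - m)%N by apply: IH; lia.
  have E1 : d (X n) (b m.+1) = (n - m.+1)%N by apply: IH; lia.
  have bb : adj (b m.+1) (b m) by rewrite adj_sym.
  have ne2 : b m.+2 <> b m by move=> /(congr1 (d (X 0%N))); rewrite !db; lia.
  by have := @codist_down _ _ _ dT' (X n) _ _ _ _ bb (ab m.+1) _ ne2; rewrite E0 E1; lia.
by move=> n m; case: (leqP n m) => le; [rewrite low|rewrite high]; lia.
Qed.

(** [Negz n] is the integer [-(n+1)], so the negative side starts at [X 1]; the common origin is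
    [a 0]. *)
Definition join_rays (S : Type) (a X : nat -> S) (i : int) :=
  match i with Posz n => a n | Negz n => X n.+1 end.

Lemma adj_join_rays (S : tree) (a X : nat -> S) : X 0%N = a 0%N ->
  (forall n, adj (X n) (X n.+1)) -> (forall n, adj (a n) (a n.+1)) ->
  forall i, adj (join_rays a X i) (join_rays a X (i + 1)%R).
Proof.
move=> X0 aX aa [n|[|n]].
- by rewrite (_ : (Posz n + 1)%R = Posz n.+1); [exact: aa|lia].
- by rewrite /= -X0 adj_sym.
- by rewrite (_ : (Negz n.+1 + 1)%R = Negz n); [rewrite /= adj_sym|lia].
Qed.

(* The missing half-line of [T] ascends with respect to [b 0], that of [T'] with
   respect to [a 0]. *)
Lemma extend_half_line (a : nat -> T) (b : nat -> T') x' :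
  (forall n, adj (a n) (a n.+1)) -> (forall n, adj (b n) (b n.+1)) ->
  (forall n m, d (a n) (b m) = (n + m)%N) -> adj (a 0%N) x' -> x' <> a 1%N ->
  exists X Y, [/\ X 1%N = x', X 0%N = a 0%N, b 0%N = Y 0%N &
                  twin_line (join_rays a X) (join_rays Y b)].
Proof.
move=> aa ab dab ax' ne.
have opp : d (a 0%N) (b 0%N) = 0%N by rewrite dab.
have [X [X0 X1 aX dX]] := exists_up_ray dT ax' opp.
have d1 : d x' (b 0%N) = 1%N by exact: (codist_opp dT ax' opp).
have [|y' by' dy'] := codist_up dT' (x := x') (y := b 0%N); first by rewrite d1.
have [Y [Y0 Y1 aY dY]] := exists_up_ray (d := fun y x => d x y) dT' by' opp.
have dXY : forall m n, d (X n) (Y m) = (n + m)%N.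
  apply: ray_codistD => // [n|m|]; first by rewrite Y0 dX.
    by rewrite X0 dY.
  by rewrite X1 Y1 dy' d1.
have dXb : forall n m, d (X n) (b m) = `|(n%:Z - m%:Z)%R|%N.
  by apply: (ray_codistB aX ab (aa 0%N) (aY 0%N)) => //; rewrite X1.
have daY : forall n m, d (a n) (Y m) = `|(n%:Z - m%:Z)%R|%N.
  by apply: (ray_codistB aa aY (aX 0%N) (ab 0%N)) => //; rewrite X1; exact: nesym.
exists X, Y; split=> //; split; [exact: adj_join_rays|exact: adj_join_rays|].
move=> [n|n] [m|m] /=; rewrite ?daY ?dab ?dXY ?dXb; lia.
Qed.

End TwinLines.

(** * Transitivity of [Lambda] *)

Section Moufang.
Variable TT : twin_tree.
Hypothesis hthick : thick TT.
Local Notation Tp := (pos TT).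
Local Notation Tm := (neg TT).
Local Notation line := (twin_line (@codist TT)).
Implicit Types (vp : int -> Tp) (vm : int -> Tm) (i j k : int).

Let cp := @codist_pos TT.
Let cm := @codist_neg TT.

Lemma twin_line_swap vp vm : line vp vm -> twin_line (fun y x => codist x y) vm vp.
Proof. by case=> ap am dv; split=> // i k; rewrite dv; lia. Qed.

Lemma twin_line_rev vp vm : line vp vm -> line (fun i => vp (- i)%R) (fun i => vm (- i)%R).
Proof.
case=> ap am dv; split=> [i|i|i k] /=; last by rewrite dv; lia.
  by rewrite adj_sym (_ : (- i)%R = (- (i + 1) + 1)%R) //; lia.
by rewrite adj_sym (_ : (- i)%R = (- (i + 1) + 1)%R) //; lia.
Qed.

Lemma twin_line_apartment vp vm : line vp vm -> twin_apartment (range vp, range vm).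
Proof.
move=> vv; have [ap am dv] := vv.
have gp := twin_line_geodesic cm vv.
have gm := twin_line_geodesic cp (twin_line_swap vv).
split=> /=; [by exists vp|by exists vm| |].
  move=> _ [i _ <-]; exists (vm i); split.
    by split; [exists i|rewrite /opposite dv; lia].
  by move=> _ [[k _ <-]]; rewrite /opposite dv => E; congr vm; lia.
move=> _ [i _ <-]; exists (vp i); split.
  by split; [exists i|rewrite /opposite dv; lia].
by move=> _ [[k _ <-]]; rewrite /opposite dv => E; congr vp; lia.
Qed.

Lemma geodesic_inj (T : tree) (v : int -> T) : geodesic v -> injective v.
Proof. by move=> geo i k E; have := geo i k; rewrite E distxx; lia. Qed.

Lemma twin_apartment_line L : twin_apartment L ->
  exists vp vm, line vp vm /\ L = (range vp, range vm).
Proof.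
case: L => Lp Lm [/= [v gv ->] [v' gv' ->]] opp opp'.
have fex i : exists k, opposite (v i) (v' k).
  have [|y [[[k _ <-] ok] _]] := opp (v i); first by exists i.
  by exists k.
have [f fP] := choice fex.
(* [f i] is the index of the opposite of [v i]. Computing the codistance from either line shows that
   [f] maps consecutive integers to consecutive integers, so the second line can be renumbered by
   [f]. *)
have dv k i : codist (v i) (v' (f k)) = `|(i - k)%R|%N.
  apply: (line_codist cm gv) (fP k) _ i => i oi.
  have [|x [_ xu]] := opp' (v' (f k)); first by exists (f k).
  apply: (geodesic_inj gv); rewrite -(xu (v i)); first exact: xu.
  by split=> //; exists i.
have dv' i k : codist (v i) (v' k) = `|(k - f i)%R|%N.
  apply: (line_codist (d := fun y x => codist x y) cp gv') (fP i) _ k => k ok.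
  have [|y [_ yu]] := opp (v i); first by exists i.
  apply: (geodesic_inj gv'); rewrite -(yu (v' k)); first exact: yu.
  by split=> //; exists k.
exists v, (v' \o f); split; last first.
  congr pair; apply/seteqP; split=> _ [k _ <-]; last by exists (f k).
  have [|x [[[i _ <-] oi] _]] := opp' (v' k); first by exists k.
  exists i => //=; congr v'.
  by move: oi; rewrite /opposite dv'; lia.
split=> [i|i|i k]; [|apply: dist1_adj; rewrite /= gv'|exact: dv].
  by apply: dist1_adj; rewrite gv; lia.
by have := dv (i + 1)%R i; rewrite dv'; lia.
Qed.

Lemma twin_line_numbering vp vm : line vp vm -> numbering (range vp, range vm) vp vm.
Proof.
move=> vv; have [ap am dv] := vv.
split=> //.
- by split=> //; exact: geodesic_inj (twin_line_geodesic cm vv).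
- by split=> //; exact: geodesic_inj (twin_line_geodesic cp (twin_line_swap vv)).
- by move=> j; rewrite /opposite dv; lia.
Qed.

Lemma is_subgroup_generated (G : groupType) (S : set G) : is_subgroup (generated S).
Proof.
split.
- by move=> A [[]].
- by move=> x y gx gy A [sA SA]; case: (sA) => _ AM _; apply: AM; [exact: gx|exact: gy].
- by move=> x gx A [sA SA]; case: (sA) => _ _ AV; apply: AV; exact: gx.
Qed.

Lemma is_subgroup_Lambda : is_subgroup (@Lambda TT).
Proof. exact: is_subgroup_generated. Qed.

Lemma Lambda_twin_auts : @Lambda TT `<=` @twin_auts TT.
Proof.
apply: smallest_sub; first exact: is_subgroup_twin_auts.
by move=> u [L [a [_ _ _ []]]].
Qed.

Definition moufang_line vp vm := line vp vm /\
  forall a, twin_root_of (range vp, range vm) a -> is_root_group a.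

Lemma moufang_line_rev vp vm : moufang_line vp vm ->
  moufang_line (fun i => vp (- i)%R) (fun i => vm (- i)%R).
Proof.
move=> [vv mv]; split; first exact: twin_line_rev.
suff rangeN (S : Type) (v : int -> S) : range (fun i : int => v (- i)%R) = range v.
  by rewrite !rangeN.
apply/seteqP; split=> _ [i _ <-]; exists (- i)%R => //=.
by rewrite GRing.opprK.
Qed.

(** The twin root at [j] and the vertex [x'] extend to another twin apartment, which an element of
    the root group maps onto the given one. The image of [x'] is a neighbour of [vp j] on the line
    other than the fixed [vp (j + 1)]. *)
Lemma moufang_half_line vp vm j x' : moufang_line vp vm ->
  adj (vp j) x' -> x' <> vp (j + 1)%R ->
  exists u, [/\ Lambda u, forall i, (j <= i)%R -> u.1 (vp i) = vp i,
    forall i, (i <= j)%R -> u.2 (vm i) = vm i & u.1 x' = vp (j - 1)%R].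
Proof.
move=> [vv mv] jx ne; have [ap am dv] := vv.
pose a n := vp (j + Posz n)%R; pose b n := vm (j - Posz n)%R.
have aa n : adj (a n) (a n.+1).
  by rewrite /a (_ : (j + n.+1)%R = (j + n + 1)%R) //; lia.
have ab n : adj (b n) (b n.+1).
  by rewrite adj_sym /b [X in adj _ (vm X)](_ : _ = (j - Posz n.+1 + 1)%R) //; lia.
have dab n m : codist (a n) (b m) = (n + m)%N by rewrite dv; lia.
have a0 : a 0%N = vp j by rewrite /a GRing.addr0.
have ax' : adj (a 0%N) x' by rewrite a0.
have [X [Y [X1 X0 Y0 gl]]] := extend_half_line cp cm aa ab dab ax' ne.
pose r := TwinRoot [set vp i | i in [set i | (j <= i)%R]]
                   [set vm i | i in [set i | (i <= j)%R]] (vp j) (vm j).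
have rL : twin_root_of (range vp, range vm) r.
  by exists vp, vm, j; split; [exact: twin_line_numbering|left].
have [||u ur [/= uL _]] := mv r rL _ _ (twin_line_apartment gl) (twin_line_apartment vv).
- split=> _ /= [i ji <-].
    exists (Posz `|(i - j)%R|%N) => //=; rewrite /a; congr vp; move: ji => /=; lia.
  have [n E] : exists n, i = (j - Posz n)%R by exists `|(i - j)%R|%N; move: ji => /=; lia.
  rewrite E; case: n {E} => [|n]; first by exists 0%R => //=; rewrite -Y0.
  by exists (Negz n).
- by split=> _ /= [i _ <-]; exists i.
have [uA up um _ _] := ur.
have upi i : (j <= i)%R -> u.1 (vp i) = vp i by move=> ji; apply: up; exists i.
have : [set u.1 x | x in range (join_rays a X)] (u.1 x').
  by exists x' => //; exists (Negz 0) => //=.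
rewrite uL => -[i _ ui]; exists u; split=> //.
- apply: sub_gen_smallest; exists (range vp, range vm), r; split=> //.
    exact: twin_line_apartment.
  exact: mv.
- by move=> k kj; apply: um; exists k.
have gp := twin_line_geodesic cm vv.
have : dist (vp j) (vp i) = 1%N.
  by apply: adj_dist; rewrite ui -(upi j) ?aut_adj //; lia.
rewrite gp -ui => ij.
have : i <> (j + 1)%R.
  move=> E; apply: ne; apply: (@aut_injective _ u.1); rewrite -ui E upi //; lia.
by move=> ij'; congr vp; lia.
Qed.

Definition Lambda_pair (x : Tp) (y : Tm) := [set u | [/\ @Lambda TT u, u.1 x = x & u.2 y = y]].

Lemma is_subgroup_Lambda_pair x y : is_subgroup (Lambda_pair x y).
Proof.
have [H1 HM HV] := is_subgroup_Lambda; split=> //.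
  by move=> u v [Hu ux uy] [Hv vx vy]; split; [exact: HM|rewrite /= vx|rewrite /= vy].
by move=> u [Hu ux uy]; split; [exact: HV|rewrite /= -{1}ux aut_funK|rewrite /= -{1}uy aut_funK].
Qed.

Lemma Lambda_pair_prev vp vm j x' : moufang_line vp vm -> adj (vp j) x' ->
  exists2 u, Lambda_pair (vp j) (vm j) u & u.1 x' = vp (j - 1)%R.
Proof.
move=> mv jx; have [vv _] := mv; have [ap am dv] := vv.
have next z : adj (vp j) z -> z <> vp (j + 1)%R ->
    exists2 u, Lambda_pair (vp j) (vm j) u & u.1 z = vp (j - 1)%R.
  move=> jz /(moufang_half_line mv jz)[u [Lu up um uz]]; exists u => //.
  by split=> //; [rewrite up|rewrite um].
have [E|] := pselect (x' = vp (j + 1)%R); last exact: next.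
(* The root at [j] fixes [vp (j + 1)], so a third neighbour [c] serves as intermediary: [v], from
   the reversed line, maps [c] to [vp (j + 1)], and [u] maps it to [vp (j - 1)]. *)
have [c [jc ne1 ne2]] := thick_avoid (vp j) (vp (j + 1)%R) (vp (j - 1)%R) hthick.1.
have [u [Lu ux uy] uc] := next c jc ne1.
have [||v [Lv vp_ vm_ vc]] := @moufang_half_line _ _ (- j)%R c (moufang_line_rev mv).
- by rewrite /= GRing.opprK.
- by rewrite /= (_ : (- (- j + 1))%R = (j - 1)%R) //; lia.
have sL := is_subgroup_Lambda_pair (vp j) (vm j); have [_ HM HV] := sL.
have Pv : Lambda_pair (vp j) (vm j) v.
  split=> //; first by have := vp_ (- j)%R; rewrite /= GRing.opprK; apply; lia.
  by have := vm_ (- j)%R; rewrite /= GRing.opprK; apply; lia.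
exists (u * v^-1); first by apply: HM => //; exact: HV.
suff -> : x' = v.1 c by rewrite /= aut_funK.
by rewrite vc E /=; congr vp; lia.
Qed.

Lemma Lambda_pair_nbrs vp vm j x1 x2 : moufang_line vp vm ->
  adj (vp j) x1 -> adj (vp j) x2 -> exists2 u, Lambda_pair (vp j) (vm j) u & u.1 x1 = x2.
Proof.
move=> mv /(Lambda_pair_prev mv)[u Pu u1] /(Lambda_pair_prev mv)[v Pv v2].
have [_ HM HV] := is_subgroup_Lambda_pair (vp j) (vm j).
exists (v^-1 * u); first by apply: HM => //; exact: HV.
by rewrite /= u1 -v2 aut_funK.
Qed.

Lemma Lambda_line_neg vp vm y : moufang_line vp vm ->
  exists u j, @Lambda TT u /\ u.2 y = vm j.
Proof.
move=> mv; have [[ap am dv] _] := mv.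
have [L1 LM LV] := is_subgroup_Lambda.
elim/(@tree_ind Tm (vm 0%R)): y => [|y y' [u [j [Lu uy]]] yy'].
  by exists 1, 0%R.
have jy : adj (vm j) (u.2 y') by rewrite -uy aut_adj.
have d1 : codist (vp j) (u.2 y') = 1%N.
  by apply: (codist_opp cp jy); rewrite dv; lia.
(* Moving the ascending neighbour [x'] to [vp (j + 1)] forces [u.2 y'] onto the unique neighbour of
   [vm j] at codistance 2 from [vp (j + 1)], namely [vm (j - 1)]. *)
have [|x' jx] := codist_up cm (x := u.2 y') (y := vp j); first by rewrite d1.
rewrite d1 => d2.
have [v [Lv vp_ vm_] vx] := Lambda_pair_nbrs mv jx (ap j).
exists (v * u), (j - 1)%R; split; first exact: LM.
apply: (codist_up_uniq cp (x := vp (j + 1)%R) (y := vm j)).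
- by rewrite dv; lia.
- by rewrite /= -{1}vm_ aut_adj.
- by have := am (j - 1)%R; rewrite adj_sym GRing.subrK.
- by rewrite -vx (Lambda_twin_auts Lv) d2 vx dv; lia.
- by rewrite !dv; lia.
Qed.

(** A path from [vp j] to [x] is folded onto the line edge by edge. A descending edge uses a root
    group fixing [vm j]; an ascending edge already lies on the line, except at codistance 0, where
    [Lambda_pair] rotates it. *)
Lemma Lambda_line_pos vp vm j x : moufang_line vp vm ->
  exists u, [/\ @Lambda TT u, u.2 (vm j) = vm j & u.1 x = vp (j + (codist x (vm j))%:Z)%R].
Proof.
move=> mv; have [[ap am dv] _] := mv.
have [L1 LM LV] := is_subgroup_Lambda.
elim/(@tree_ind Tp (vp j)): x => [|x x' [u [Lu um ux]] xx'].
  by exists 1; split=> //; rewrite dv (_ : (_ + _)%R = j) //; lia.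
have dx' : codist (u.1 x') (vm j) = codist x' (vm j).
  by rewrite -{1}um (Lambda_twin_auts Lu).
have ca : adj (vp (j + (codist x (vm j))%:Z)%R) (u.1 x') by rewrite -ux aut_adj.
case: (codist_adj cm (vm j) xx') => dxx'; last first.
  have [|v [Lv vp_ vm_ vx]] := moufang_half_line mv ca.
    by move=> E; move: dx'; rewrite E dv; lia.
  exists (v * u); split; [exact: LM|by rewrite /= um vm_ //; lia|].
  by rewrite /= vx; congr vp; lia.
have [c0|c0] := posnP (codist x (vm j)).
  move: ca; rewrite c0 GRing.addr0 => ca.
  have [v [Lv vp_ vm_] vx] := Lambda_pair_nbrs mv ca (ap j).
  by exists (v * u); split; [exact: LM|rewrite /= um|rewrite /= vx dxx' c0].
exists u; split=> //; rewrite dxx'.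
apply: (codist_up_uniq cm (x := vm j) (y := vp (j + codist x (vm j))%R)) => //.
- by rewrite dv; lia.
- have := ap (j + codist x (vm j))%R.
  by rewrite (_ : (_ + 1)%R = (j + (codist x (vm j)).+1)%R) //; lia.
- by rewrite dx' dxx' dv; lia.
- by rewrite !dv; lia.
Qed.

Hypothesis hmoufang : moufang TT.

Lemma exists_moufang_line : exists vp vm, moufang_line vp vm.
Proof.
have [L /twin_apartment_line[vp [vm [vv ->]]] mL] := hmoufang.
by exists vp, vm; split.
Qed.

Lemma Lambda_transitive_opposite z z' y : opposite z y -> opposite z' y ->
  exists2 u, stab (@Lambda TT) y u & u.1 z = z'.
Proof.
move=> oz oz'; have [vp [vm mv]] := exists_moufang_line.
have [_ LM LV] := is_subgroup_Lambda.
have [g [j [Lg gy]]] := Lambda_line_neg y mv.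
have std x : opposite x y -> exists2 u, @Lambda TT u & u.2 y = vm j /\ u.1 x = vp j.
  move=> ox; have [h [Lh hj hx]] := Lambda_line_pos j (g.1 x) mv.
  exists (h * g); first exact: LM.
  by rewrite /= gy hj hx -gy (Lambda_twin_auts Lg) ox GRing.addr0.
have [u Lu [uy uz]] := std z oz; have [v Lv [vy vz]] := std z' oz'.
exists (v^-1 * u); last by rewrite /= uz -vz aut_funK.
by split; [apply: LM => //; exact: LV|rewrite /= uy -vy aut_funK].
Qed.

Lemma Lambda_transitive_nbrs z y w w' : opposite z y -> adj z w -> adj z w' ->
  exists2 u, Lambda_pair z y u & u.1 w = w'.
Proof.
move=> oz zw zw'; have [vp [vm mv]] := exists_moufang_line.
have [_ LM LV] := is_subgroup_Lambda.
have [g [j [Lg gy]]] := Lambda_line_neg y mv.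
have [h [Lh hj hx]] := Lambda_line_pos j (g.1 z) mv.
pose k := h * g; have Lk : Lambda k by exact: LM.
have ky : k.2 y = vm j by rewrite /= gy.
have kz : k.1 z = vp j by rewrite /= hx -gy (Lambda_twin_auts Lg) oz GRing.addr0.
have kw : adj (vp j) (k.1 w) by rewrite -kz aut_adj.
have kw' : adj (vp j) (k.1 w') by rewrite -kz aut_adj.
have [u [Lu up um] uw] := Lambda_pair_nbrs mv kw kw'.
exists (k^-1 * (u * k)); last by rewrite [LHS]/= uw; exact: (aut_funK k.1).
split; first by apply: (LM); [exact: LV|exact: LM].
  by change (aut_inv k.1 (u.1 (k.1 z)) = z); rewrite kz up -kz aut_funK.
by change (aut_inv k.2 (u.2 (k.2 y)) = y); rewrite ky um -ky aut_funK.
Qed.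

End Moufang.

(** * Automorphisms twisted by a cocycle *)

Section TreeMaps.
Variables (T T' : tree) (d : T -> T' -> nat).
Hypothesis dT' : codistance_axiom d.
Hypothesis dT : codistance_axiom (fun y x => d x y).
Hypothesis thT' : thick_tree T'.

(** Each vertex other than [z] has a unique neighbour nearer to [z]; [c] multiplies the edge values
    along the resulting path from [z]. *)
Lemma tree_cocycle (G : groupType) (j : T -> T -> G) z :
  (forall p q, j q p = (j p q)^-1) ->
  exists c : T -> G, c z = 1 /\ forall p q, adj p q -> c q = c p * j p q.
Proof.
move=> jV.
have par q : exists p, dist q z <> 0%N -> adj q p /\ dist q z = (dist p z).+1.
  case E : (dist q z) => [|n]; first by exists q.
  by have [p qp <-] := dist_step E; exists p.
have [f fP] := choice par.
pose F := fix F n q : G := if n is m.+1 then F m (f q) * j (f q) q else 1.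
have step p q : adj p q -> dist q z = (dist p z).+1 ->
    F (dist q z) q = F (dist p z) p * j p q.
  move=> pq D; rewrite D /=; suff -> : f q = p by [].
  have [|qf Df] := fP q; first by rewrite D.
  apply: (closer_uniq dT' dT thT' (x := q) (z := z)) => //; try lia.
  by rewrite adj_sym.
exists (fun q => F (dist q z) q); split; first by rewrite distxx.
move=> p q pq; case: (adj_dist_cases dT z pq) => D; last exact: step.
have qp : adj q p by rewrite adj_sym.
by rewrite (step q p) // -mulgA (jV q p) mulgV mulg1.
Qed.

Section LocallyBijective.
Variable h : T -> T.
Hypothesis h_adj : forall p q, adj p q -> adj (h p) (h q).
Hypothesis h_inj : forall p q1 q2, adj p q1 -> adj p q2 -> h q1 = h q2 -> q1 = q2.
Hypothesis h_surj : forall p r, adj (h p) r -> exists2 q, adj p q & h q = r.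

Lemma locally_bijective_dist p q : dist (h p) (h q) = dist p q.
Proof.
suff H n : (forall p, dist p q = n -> dist (h p) (h q) = n) /\
           (forall p, dist p q = n.+1 -> dist (h p) (h q) = n.+1).
  by have [H0 _] := H (dist p q); exact: H0.
elim: n => [|n [IH0 IH1]]; split=> // {}p E; first by rewrite (dist0 E) distxx.
  by apply: adj_dist; apply: h_adj; exact: dist1_adj.
have [p1 pp1 D1] := dist_step E; have [p2 p12 D2] := dist_step D1.
have p1p : adj p1 p by rewrite adj_sym.
have H1 := IH1 _ D1; have H2 := IH0 _ D2.
case: (adj_dist_cases dT (h q) (h_adj pp1)) => H; first by rewrite H H1.
(* Otherwise the image path backtracks: [h p] and [h p2] are both the neighbour of [h p1] nearer to
   [h q], against local injectivity. *)
have E2 : h p = h p2.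
  apply: (closer_uniq dT' dT thT' (x := h p1) (z := h q)); try exact: h_adj.
  - by rewrite H.
  - by rewrite H1 H2.
by have := h_inj p1p p12 E2 => Ep; move: E; rewrite Ep D2; lia.
Qed.

Lemma locally_bijective_aut : exists g : aut T, forall p, g p = h p.
Proof.
have [z _] := tree_nonempty T.
have surj r : exists p, h p = r.
  elim/(@tree_ind T (h z)): r => [|r r' [p <-]]; first by exists z.
  by move=> /h_surj[q _ <-]; exists q.
have [f fK] := choice surj.
have hf : cancel h f.
  by move=> p; apply: dist0; rewrite -locally_bijective_dist fK distxx.
have h_adjE p q : adj (h p) (h q) = adj p q.
  apply/idP/idP; last exact: h_adj.
  by move=> /adj_dist; rewrite locally_bijective_dist => /dist1_adj.
by exists (Aut hf fK h_adjE).
Qed.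

End LocallyBijective.

End TreeMaps.

(** * The commensurating automorphism that exchanges two branches *)

Section TwistedAutomorphism.
Variable TT : twin_tree.
Hypotheses (hthick : thick TT) (hlf : locally_finite TT).
Local Notation Tp := (pos TT).
Local Notation Tm := (neg TT).

Let cp := @codist_pos TT.
Let cm := @codist_neg TT.

Variables (y : Tm) (z : Tp) (F : set Tp).
Hypotheses (opp : opposite z y) (finF : finite_subtree F) (Fz : F z).
Local Notation K := (stab (@twin_auts TT) y).

(* The subgroup fixes, for each of the finitely many elements to be excluded, a
   vertex of [T_-] moved by that element. *)
Lemma residual_subgroup : exists D : set (aut Tp * aut Tm),
  [/\ is_subgroup D, D `<=` K, finitely_covers D K & forall u, D u -> F (u.1 z) -> u = 1].
Proof.
have sK := is_subgroup_stab y (is_subgroup_twin_auts TT); have [K1 KM KV] := sK.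
have finE : finite_set [set u | K u /\ F (u.1 z)].
  apply: (@sub_finite_set _ _ (\bigcup_(q in F) [set u | K u /\ u.1 z = q])).
    by move=> u [Ku Fu]; exists (u.1 z).
  apply: bigcup_finite => [|q _]; first by case: finF.
  have [[v [Kv vz]]|no] := pselect (exists v, K v /\ v.1 z = q); last first.
    by apply: sub_finite_set (finite_set0 _) => u Hu; apply: no; exists u.
  apply: sub_finite_set (finite_image (fun u => v * u) (finite_stab hthick hlf opp)).
  move=> u [Ku uz]; exists (v^-1 * u); last by rewrite mulVKg.
  split; first by apply: KM => //; exact: KV.
  by rewrite /= uz -vz aut_funK.
have moved (u : aut Tp * aut Tm) : exists q : Tm, u.2 q = q -> K u -> u = 1.
  have [fix2|] := pselect (forall q, u.2 q = q); last first.
    by rewrite -existsNE => -[q nq]; exists q.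
  exists y => _ [uA _]; rewrite [u]surjective_pairing; congr (_, _); apply: autP => // x.
  apply: (codist_separates cp cm hthick.2) => q.
  by rewrite -{1}(fix2 q) uA.
have [m mP] := choice moved.
have [s sE] := (finite_seqP _).1 (finite_image m finE).
exists [set u | K u /\ forall p, p \in s -> u.2 p = p]; split.
- split=> //.
    move=> u v [Ku us] [Kv vs]; split; first exact: KM.
    by move=> p ps; rewrite /= vs // us.
  move=> u [Ku us]; split; first exact: KV.
  by move=> p ps; rewrite /= -{1}(us p ps) aut_funK.
- by move=> u [].
- by apply: (@fixator_covers Tm _ snd _ _ K y hlf.2 sK) => // u [].
- move=> u [Ku us] Fu; apply: mP => //; apply: us.
  have : [set` s] (m u) by rewrite -sE; exists u.
  by [].
Qed.

Variables (D : set (aut Tp * aut Tm)) (w w' : Tp) (s : aut Tp * aut Tm).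
Hypotheses (sD : is_subgroup D) (DK : D `<=` K) (covD : finitely_covers D K).
Hypothesis D_F : forall u, D u -> F (u.1 z) -> u = 1.
Hypotheses (zw : adj z w) (zw' : adj z w') (ww' : w <> w').
Hypotheses (Fw : ~ F w) (Fw' : ~ F w').
Hypotheses (Ks : K s) (sz : s.1 z = z) (sw : s.1 w = w').
Hypothesis K_transitive : forall x, opposite x y -> exists2 u, K u & u.1 x = z.

Let sK : is_subgroup K := is_subgroup_stab y (is_subgroup_twin_auts TT).

Let D_free u v : D u -> D v -> u.1 z = v.1 z -> u = v.
Proof.
move=> Du Dv E; have [_ DM DV] := sD.
have E1 : u^-1 * v = 1.
  by apply: D_F; [apply: DM => //; exact: DV|rewrite /= -E aut_funK].
by rewrite -[v](mulVKg u) E1 mulg1.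
Qed.

(* The swap of the branches at [w] and [w'], transported along the orbit of
   [z]: crossing the edge from [p] to [q] multiplies the local automorphism by
   the twist [g]. *)
Definition twist p q (g : aut Tp * aut Tm) := exists2 u, D u &
  p = u.1 z /\ ((q = u.1 w /\ g = u * s * u^-1) \/ (q = u.1 w' /\ g = u * s^-1 * u^-1)).

Definition twist_at p q := xget 1 (twist p q).

(** Dividing by the value on the reversed edge makes reversal act by inversion. At most one factor
    is nontrivial, as the orbit of [z] under [D] consists of vertices opposite [y], no two of them
    adjacent. *)
Definition twist_cocycle p q := twist_at p q * (twist_at q p)^-1.

(** [D] acts freely on the orbit of [z], so [p] determines [u]; then [w <> w'] decides between the
    two branches. *)
Lemma twist_uniq p q g g' : twist p q g -> twist p q g' -> g = g'.
Proof.
move=> [u Du [-> H]] [v Dv [/(D_free Du Dv) <- H']] {v Dv}.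
case: H H' => [[-> ->]|[-> ->]] [[/aut_injective E ->]|[/aut_injective E ->]] //.
by case: ww'.
Qed.

Lemma twist_atE p q g : twist p q g -> twist_at p q = g.
Proof. by move=> H; apply: xget_unique => // g' H'; exact: twist_uniq H' H. Qed.

Lemma twist_at_cases p q : twist_at p q = 1 \/ twist p q (twist_at p q).
Proof.
have [[g tg]|no] := pselect (exists g, twist p q g).
  by right; rewrite (twist_atE tg).
by left; apply: xgetPN => g tg; apply: no; exists g.
Qed.

Lemma twist_conj u p q g : D u -> twist p q g -> twist (u.1 p) (u.1 q) (u * g * u^-1).
Proof.
move=> Du [v Dv [-> H]]; have [_ DM _] := sD.
exists (u * v); [exact: DM|split=> //].
by case: H => -[-> ->]; [left|right]; split=> //; rewrite invgM !mulgA.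
Qed.

Lemma twist_at_conj u p q : D u -> twist_at (u.1 p) (u.1 q) = u * twist_at p q * u^-1.
Proof.
move=> Du; have [E|t] := twist_at_cases p q; last exact: twist_atE (twist_conj Du t).
have [E'|t] := twist_at_cases (u.1 p) (u.1 q); first by rewrite E E' mulg1 mulgV.
have [_ _ DV] := sD; have := twist_conj (DV u Du) t; rewrite /= !aut_funK => /twist_atE ->.
by rewrite invgK !mulgA mulgV mul1g mulgK.
Qed.

Lemma twist_cocycle_conj u p q : D u ->
  twist_cocycle (u.1 p) (u.1 q) = u * twist_cocycle p q * u^-1.
Proof.
by move=> Du; rewrite /twist_cocycle !twist_at_conj // !invgM invgK !mulgA mulgVK.
Qed.

Lemma opposite_orbit u : K u -> codist (u.1 z) y = 0%N.
Proof. by case=> uA {1}<-; rewrite uA. Qed.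

Let not_orbit u v p : D u -> D v -> adj (u.1 z) p -> p <> v.1 z.
Proof.
move=> /DK/opposite_orbit ou /DK/opposite_orbit ov up E.
by have := codist_opp cm up ou; rewrite E ov.
Qed.

Let twist_at_out u p : D u -> adj (u.1 z) p -> twist_at p (u.1 z) = 1.
Proof.
move=> Du up; case: (twist_at_cases p (u.1 z)) => // -[v Dv [Ep _]].
by case: (not_orbit Du Dv up Ep).
Qed.

Lemma twist_cocycle_w u : D u -> twist_cocycle (u.1 z) (u.1 w) = u * s * u^-1.
Proof.
move=> Du; rewrite /twist_cocycle twist_at_out // ?aut_adj // invg1 mulg1.
by apply: twist_atE; exists u => //; split=> //; left.
Qed.

Lemma twist_cocycle_w' u : D u -> twist_cocycle (u.1 z) (u.1 w') = u * s^-1 * u^-1.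
Proof.
move=> Du; rewrite /twist_cocycle twist_at_out // ?aut_adj // invg1 mulg1.
by apply: twist_atE; exists u => //; split=> //; right.
Qed.

Let sw' : aut_inv s.1 w' = w. Proof. by rewrite -sw aut_funK. Qed.

(** On an edge entering the orbit at [v = u.1 z], the twist is a conjugate of [s] or its inverse,
    and these fix [v] because [s] fixes [z]. *)
Lemma twist_cocycle_fix p v : adj p v -> (twist_cocycle p v).1 v <> v ->
  exists2 u, D u & p = u.1 z /\ (v = u.1 w \/ v = u.1 w').
Proof.
move=> pv; rewrite /twist_cocycle.
case: (twist_at_cases v p) => [->|[u Du [Ev H]]].
  rewrite invg1 mulg1; case: (twist_at_cases p v) => [->|[u Du [Ep H]]] // _.
  by exists u => //; split=> //; case: H => -[-> _]; [left|right].
move=> []; rewrite Ev twist_at_out // -?Ev 1?adj_sym // mul1g.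
have sz' : aut_inv s.1 z = z by rewrite -{1}sz aut_funK.
by case: H => -[_ ->]; rewrite !invgM !invgK Ev /= aut_funK ?sz ?sz'.
Qed.

(** About [u.1 z] the local map exchanges [u.1 w] and [u.1 w'], and it fixes all other neighbours.
    Being an involution, it makes the twisted map locally bijective. *)
Lemma twist_cocycle_involutive p v : adj p v ->
  (twist_cocycle p ((twist_cocycle p v).1 v)).1 ((twist_cocycle p v).1 v) = v.
Proof.
move=> pv; have [E|] := pselect ((twist_cocycle p v).1 v = v); first by rewrite !E.
case/(twist_cocycle_fix pv) => u Du [-> [->|->]].
  rewrite twist_cocycle_w // [X in twist_cocycle _ X]/= aut_funK sw twist_cocycle_w' //=.
  by rewrite !aut_funK.
rewrite twist_cocycle_w' // [X in twist_cocycle _ X]/= aut_funK sw' twist_cocycle_w //=.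
by rewrite !aut_funK aut_invK.
Qed.

Lemma twist_cocycle_adj p v : adj p v -> adj p ((twist_cocycle p v).1 v).
Proof.
move=> pv; have [->|] := pselect ((twist_cocycle p v).1 v = v); first by [].
case/(twist_cocycle_fix pv) => u Du [-> [->|->]].
  by rewrite twist_cocycle_w //= aut_funK sw aut_adj.
by rewrite twist_cocycle_w' //= aut_funK sw' aut_adj.
Qed.

Lemma twist_cocycle_stab p q : K (twist_cocycle p q).
Proof.
have [K1 KM KV] := sK.
have Kt a b : K (twist_at a b).
  case: (twist_at_cases a b) => [->//|[u /DK Ku [_ H]]].
  have Ku' := KV _ Ku; have Ks' := KV _ Ks.
  by case: H => -[_ ->]; apply: (KM) => //; exact: KM.
by apply: KM => //; exact: KV.
Qed.

Lemma twist_cocycle_F p q : F p -> F q -> twist_cocycle p q = 1.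
Proof.
have one a b : F a -> F b -> twist_at a b = 1.
  move=> Fa Fb; case: (twist_at_cases a b) => // -[u Du [Ea H]].
  move: Fb Du; rewrite {}Ea in Fa; move=> Fb /D_F/(_ Fa) u1.
  by case: H Fb => -[-> _]; rewrite u1.
by move=> Fp Fq; rewrite /twist_cocycle !one // invg1 mulg1.
Qed.

Lemma twisted_automorphism : exists h : aut Tp,
  [/\ forall p, F p -> h p = p, h w = w' & commensurates (fst @` K) h].
Proof.
have [K1 KM KV] := sK; have [D1 DM DV] := sD.
have jV p q : twist_cocycle q p = (twist_cocycle p q)^-1.
  by rewrite /twist_cocycle invgM invgK.
have [c [cz cE]] := tree_cocycle cp cm hthick.2 z jV.
have Kc p : K (c p).
  elim/(@tree_ind Tp z): p => [|p q Kp pq]; first by rewrite cz.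
  by rewrite (cE _ _ pq); apply: KM => //; exact: twist_cocycle_stab.
pose h0 p := (c p).1 p.
have h0E p q : adj p q -> h0 q = (c p).1 ((twist_cocycle p q).1 q).
  by move=> pq; rewrite /h0 (cE p).
have [||p r|h hE] := @locally_bijective_aut _ _ _ cp cm hthick.2 h0.
- by move=> p q pq; rewrite (h0E p q) // aut_adj; exact: twist_cocycle_adj.
- move=> p q1 q2 pq1 pq2; rewrite (h0E p q1) // (h0E p q2) // => /aut_injective E.
  by rewrite -(twist_cocycle_involutive pq1) E twist_cocycle_involutive.
- move=> pr; have pr' : adj p (aut_inv (c p).1 r).
    by rewrite -(aut_adj (c p).1) aut_invK.
  exists ((twist_cocycle p (aut_inv (c p).1 r)).1 (aut_inv (c p).1 r)).
    exact: twist_cocycle_adj.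
  by rewrite (h0E p) ?twist_cocycle_involutive ?aut_invK //; exact: twist_cocycle_adj.
(* Equivariance of the edge values, integrated along paths from [z]; it yields [hu], by which [h]
   conjugates [D] into [K]. *)
have c_conj u p : D u -> c (u.1 p) = c (u.1 z) * u * c p * u^-1.
  move=> Du; elim/(@tree_ind Tp z): p => [|p q IH pq]; first by rewrite cz mulg1 mulgK.
  have upq : adj (u.1 p) (u.1 q) by rewrite aut_adj.
  by rewrite (cE _ _ upq) IH twist_cocycle_conj // (cE _ _ pq) !mulgA mulgVK.
have h_conj u p : D u -> h (u.1 p) = (c (u.1 z) * u).1 (h p).
  by move=> Du; rewrite !hE /h0 c_conj //= aut_funK.
have hu u : D u -> h * u.1 * h^-1 = (c (u.1 z) * u).1.
  by move=> Du; apply: autP => p; rewrite -[in RHS](aut_invK h p) -h_conj.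
have c_F p : F p -> c p = 1.
  move=> Fp; case: finF => _ _ /(_ z p Fz Fp)[l [pl <- lF]] {Fp p}.
  have cF : forall p, c p = 1 -> F p -> path adj p l -> c (last p l) = 1.
    elim: l lF {pl} => //= a l IH lF p cp1 Fp /andP[pa al].
    have Fa : F a by apply: lF; rewrite inE eqxx.
    apply: IH => //; first by move=> b bl; apply: lF; rewrite inE bl orbT.
    by rewrite (cE _ _ pa) cp1 twist_cocycle_F // mulg1.
  exact: cF.
have hopp p : codist (h p) y = codist p y.
  by rewrite hE /h0; have [cA {1}<-] := Kc p; rewrite cA.
exists h; split.
- by move=> p Fp; rewrite hE /h0 c_F.
- rewrite hE (h0E z w) // cz.
  by have := twist_cocycle_w D1; rewrite !aut1 => ->; rewrite mul1g invg1 mulg1.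
have cov_image A B : finitely_covers A B -> finitely_covers (fst @` A) (fst @` B).
  by apply: finitely_covers_image.
have sub_image : fst @` D `<=` fst @` K by exact: image_subset.
have KD : commensurable (fst @` K) (fst @` D).
  by split; [exact: sub_finitely_covers|exact: cov_image].
apply: commensurable_trans (commensurable_sym (commensurable_conj h KD)).
split.
  apply: sub_finitely_covers => _ [_ [u Du <-] <-].
  exists (c (u.1 z) * u); last by rewrite hu.
  by apply: KM => //; exact: DK.
have [C finC CK] := covD.
(* The formula of [hu] for [a^-1], now with [a] outside [D]: [e a] lies in [K] and maps [z] to
   [h (a^-1.1 z)], though it need not be a conjugate by [h]. *)
pose e (a : aut Tp * aut Tm) := c (a^-1.1 z) * a^-1.
exists [set (f * (e a)^-1).1 | f in [set f | K f /\ f.1 z = z] & a in C].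
  by apply: finite_image2 => //; exact: finite_stab.
move=> _ [u Ku <-].
(* As [p] is opposite [y], some [k] in [K] maps it to [z]. With [k = a * v], [v] in [D], and [m]
   inducing [h v^-1 h^-1], the product [u * m * e a] fixes [z] and so lies in a finite set. *)
pose p := h^-1 (u^-1.1 z).
have op : opposite p y.
  rewrite /opposite -hopp /p (aut_invK h).
  exact: opposite_orbit (KV _ Ku).
have [k Kk kp] := K_transitive op.
have [a Ca Da] := CK _ Kk.
pose v := a^-1 * k.
have Ke : K (e a).
  have -> : a = k * v^-1 by rewrite /v invgM invgK mulVKg.
  apply: (KM) => //; apply: (KV); apply: (KM) => //; apply: KV; exact: DK.
pose m := c (v^-1.1 z) * v^-1.
have Km : K m by apply: KM => //; apply: DK; exact: DV.
have hv : h * (v.1)^-1 * h^-1 = m.1 by exact: (hu _ (DV _ Da)).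
have me : m.1 ((e a).1 z) = u^-1.1 z.
  have -> : (e a).1 z = h (a^-1.1 z) by rewrite hE.
  rewrite -hv [LHS]/= aut_funK; apply: (@aut_injective _ h^-1).
  rewrite [LHS]/= aut_funK -/(p); rewrite -kp /v /=.
  by rewrite aut_invK aut_funK.
exists (u * m * e a * (e a)^-1).1.
  exists (u * m * e a) => //; last by exists a.
  split; first by apply: (KM) => //; exact: KM.
  by change (u.1 (m.1 ((e a).1 z)) = z); rewrite me; exact: (aut_invK u.1 z).
exists v.1; first by exists v.
have -> : h * v.1 * h^-1 = m^-1.1.
  have -> : m^-1.1 = (m.1)^-1 by [].
  by rewrite -hv !invgM !invgK !mulgA.
by rewrite mulgK (_ : (u * m).1^-1 * u.1 = ((u * m)^-1 * u).1) // (invgM u) mulgVK.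
Qed.

End TwistedAutomorphism.

(** * Density *)

Lemma finite_subtreeU1 (T : tree) (F : set T) z w :
  finite_subtree F -> F z -> adj z w -> finite_subtree (F `|` [set w]).
Proof.
move=> [finF F0 cF] Fz zw; split.
- by rewrite finite_setU; split=> //; exact: finite_set1.
- by exists z; left.
- move=> a b [Fa|->] [Fb|->].
  + have [p [? ? pF]] := cF a b Fa Fb; exists p; split=> // c cp.
    by left; exact: pF.
  + have [p [pp pl pF]] := cF a z Fa Fz; exists (rcons p w); split.
    * by rewrite rcons_path pp pl.
    * by rewrite last_rcons.
    * by move=> c; rewrite mem_rcons inE => /orP[/eqP->|/pF]; [right|left].
  + have [p [pp pl pF]] := cF z b Fz Fb; exists (z :: p); split=> //.
      by rewrite /= adj_sym zw.
    by move=> c; rewrite inE => /orP[/eqP->|/pF]; left.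
  + by exists [::].
Qed.

Lemma path_exit (T : tree) (F F' : set T) x l : path adj x l -> F' x ->
  (forall p, p \in l -> F p) -> ~ F' (last x l) ->
  exists z w, [/\ F' z, F w, ~ F' w & adj z w].
Proof.
elim: l x => //= a l IH x /andP[xa al] F'x lF nl.
have [F'a|nF'a] := pselect (F' a); last first.
  by exists x, a; split=> //; apply: lF; rewrite inE eqxx.
by apply: (IH a) => // p pl; apply: lF; rewrite inE pl orbT.
Qed.

Lemma ltn_count (T : eqType) (a b : pred T) (s : seq T) w :
  subpred a b -> w \in s -> b w -> ~~ a w -> (count a s < count b s)%N.
Proof.
move=> ab + bw aw; elim: s => //= x s IH; rewrite inE => /orP[/eqP<-|/IH lt].
  by rewrite bw (negbTE aw) add0n add1n ltnS; exact: sub_count.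
by rewrite -addnS; apply: leq_add lt; case: (a x) (ab x) => // ->.
Qed.

Section Density.
Variable TT : twin_tree.
Hypotheses (hthick : thick TT) (hlf : locally_finite TT) (hmoufang : moufang TT).
Local Notation Tp := (pos TT).
Local Notation Tm := (neg TT).
Local Notation A_stab y := (fst @` stab (@twin_auts TT) y).

Let cp := @codist_pos TT.
Let cm := @codist_neg TT.

Lemma finitely_covers_stab y y' :
  finitely_covers (stab (@twin_auts TT) y') (stab (@twin_auts TT) y).
Proof.
have [_ AM AV] := is_subgroup_twin_auts TT.
apply: (@finitely_covers_of_fun _ _ (fun u : aut Tp * aut Tm => u.2 y')).
  apply: sub_finite_set (finite_sphere y (dist y' y) hlf.2) => _ [u [_ uy] <-] /=.
  by rewrite -{1}uy aut_dist.
move=> u v [uA _] [vA _] E; split; first by apply: AM => //; exact: AV.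
by rewrite /= -E aut_funK.
Qed.

Lemma commensurable_stab y y' : commensurable (A_stab y) (A_stab y').
Proof. by split; apply: finitely_covers_image => //; exact: finitely_covers_stab. Qed.

Lemma commensurable_Gamma y : commensurable (A_stab y) (Gamma y).
Proof.
split.
  apply: sub_finitely_covers => _ [u [Lu uy] <-]; exists u => //; split=> //.
  exact: Lambda_twin_auts.
apply: (@finitely_covers_image _ _ fst (stab (@Lambda TT) y)) => //.
have [z oz] := exists_opposite (d := fun y x => codist x y) cm y hthick.1.
exists [set u | stab (@twin_auts TT) y u /\ u.1 z = z]; first exact: finite_stab.
have [_ KM KV] := is_subgroup_stab y (is_subgroup_twin_auts TT).
have [_ LM LV] := is_subgroup_stab y (is_subgroup_Lambda TT).
move=> k Kk.
have ok := opposite_orbit oz (KV _ Kk).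
have [l Ll lz] := Lambda_transitive_opposite hthick hmoufang oz ok.
(* [l] maps [z] to [k^-1 z], so [k * l] fixes both [z] and [y] and is one of finitely many
   representatives. *)
exists (k * l); last by rewrite invgM mulgVK; exact: LV.
split; last by rewrite /= lz; exact: (aut_invK k.1).
by apply: KM => //; split; [exact: Lambda_twin_auts Ll.1|exact: Ll.2].
Qed.

Section Commensurator.
Variable y : Tm.

Lemma commensurator_Gamma g : commensurates (A_stab y) g -> commensurator (Gamma y) g.
Proof.
move=> /(commensurates_commensurable (commensurable_Gamma y)); apply: commensuratorP.
have [S1 SM SV] := is_subgroup_stab y (is_subgroup_Lambda TT); split.
- by exists 1.
- by move=> _ _ [u Lu <-] [v Lv <-]; exists (u * v) => //; exact: SM.
- by move=> _ [u Lu <-]; exists u^-1 => //; exact: SV.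
Qed.

(** The construction needs a vertex [y'] opposite [z]; commensurability of the stabilizers transfers
    the result back to [y]. *)
Lemma commensurates_swap (F : set Tp) z w w' : finite_subtree F -> F z ->
  adj z w -> adj z w' -> ~ F w -> ~ F w' ->
  exists h, [/\ commensurates (A_stab y) h, forall p, F p -> h p = p & h w = w'].
Proof.
move=> finF Fz zw zw' Fw Fw'.
have [<-|ww'] := pselect (w = w'); first by exists 1; split=> //; exact: commensurates1.
have [y' oz] := exists_opposite cp z hthick.2.
have [D [sD DK covD D_F]] := residual_subgroup hthick hlf oz finF.
have [s [Ls sz sy] sw] := Lambda_transitive_nbrs hthick hmoufang oz zw zw'.
have LA := @Lambda_twin_auts TT.
have [|h [hF hw Ch]] := twisted_automorphism hthick hlf oz finF Fz sD DK covD D_F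
  zw zw' ww' Fw Fw' (conj (LA _ Ls) sy) sz sw.
  move=> x ox; have [u [Lu uy] ux] := Lambda_transitive_opposite hthick hmoufang ox oz.
  by exists u => //; split=> //; exact: LA.
by exists h; split=> //; apply: commensurates_commensurable Ch; exact: commensurable_stab.
Qed.

(** Move two steps at a time: a swap fixing the middle vertex [x1] takes [x] to [x2]. *)
Lemma commensurates_transitive x x' : ~~ odd (dist x x') ->
  exists2 h, commensurates (A_stab y) h & h x = x'.
Proof.
move=> ev; have := even_halfK ev; move: (dist x x')./2 => n {ev}.
elim: n x => [|n IH] x E; first by exists 1; [exact: commensurates1|exact: dist0].
have [x1 xx1 D1] := dist_step (esym E).
have [x2 x12 D2] := dist_step D1.
have x1x : adj x1 x by rewrite adj_sym.
have [|||k [Ck _ kx]] := commensurates_swap (finite_subtree1 x1) _ x1x x12 => //.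
- exact: adj_neq.
- by apply: nesym; exact: adj_neq.
have [h Ch hx] := IH x2 (esym D2); exists (h * k); first exact: commensuratesM.
by rewrite autM kx.
Qed.

Lemma commensurates_approx (g : aut Tp) (F : set Tp) x0 h0 : finite_subtree F -> F x0 ->
  commensurates (A_stab y) h0 -> h0 x0 = g x0 ->
  exists2 h, commensurates (A_stab y) h & forall p, F p -> h p = g p.
Proof.
move=> sF Fx0 Ch0 hx0; have [finF _ cF] := sF.
have [s sE] := (finite_seqP F).1 finF.
suff H n (F' : set Tp) h : (count [pred p | p \notin F'] s < n)%N -> finite_subtree F' ->
    F' x0 -> commensurates (A_stab y) h -> (forall p, F' p -> h p = g p) ->
    exists2 h, commensurates (A_stab y) h & forall p, F p -> h p = g p.
  by apply: (H _ [set x0] h0 (leqnn _) (finite_subtree1 x0) erefl Ch0) => p ->.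
elim: n F' h => // n IH F' h lt sF' F'x0 Ch hF'.
have [FF'|] := pselect (F `<=` F'); first by exists h => // p /FF'/hF'.
move=> /existsNP[q /not_implyP[Fq nF'q]].
have [l [pl lq lF]] := cF x0 q Fx0 Fq.
have [|z [w [F'z Fw nF'w zw]]] := path_exit pl F'x0 lF; first by rewrite lq.
have hgz : h^-1 (g z) = z by rewrite -hF' // autV aut_funK.
have zw' : adj z (h^-1 (g w)) by rewrite -{1}hgz !aut_adj.
have nF'w' : ~ F' (h^-1 (g w)).
  move=> F'w'; apply: nF'w; have := hF' _ F'w'.
  by rewrite (aut_invK h) => /aut_injective E; rewrite E.
(* Correcting [h] by [k] keeps the agreement with [g] on [F'] and adds [w], so fewer vertices of [F]
   remain. *)
have [k [Ck kF' kw]] := commensurates_swap sF' F'z zw zw' nF'w nF'w'.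
apply: (IH (F' `|` [set w]) (h * k)).
- move: lt; rewrite ltnS; apply: leq_trans; apply: (@ltn_count _ _ _ _ w) => /=.
  + by move=> p /=; rewrite !notin_setE => nU F'p; apply: nU; left.
  + by have : [set` s] w by rewrite -sE.
  + by rewrite notin_setE.
  + by rewrite negbK inE; right.
- exact: finite_subtreeU1 zw.
- by left.
- exact: commensuratesM.
- move=> p [F'p|->]; first by rewrite autM kF' // hF'.
  by rewrite autM kw (aut_invK h).
Qed.

Lemma commensurates_approx_even (g : aut Tp) F x0 : finite_subtree F -> F x0 ->
  ~~ odd (dist x0 (g x0)) ->
  exists2 h, commensurates (A_stab y) h & forall p, F p -> h p = g p.
Proof.
by move=> sF Fx0 /commensurates_transitive[h Ch hx]; exact: commensurates_approx hx.
Qed.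

Lemma closure_commensurator (g : aut Tp) :
  (forall F, finite_subtree F ->
    exists2 h, commensurates (A_stab y) h & forall p, F p -> h p = g p) ->
  closure (commensurator (Gamma y)) g.
Proof.
move=> approx B; rewrite nbhsE => -[U [oU Ug] UB].
have [F sF FU] := oU g Ug; have [h Ch hF] := approx F sF.
exists h; split; first exact: commensurator_Gamma.
apply: UB; rewrite -[h](mulVKg g); apply: FU => p Fp.
by rewrite autM hF // autV aut_funK.
Qed.

Lemma dense_commensurator :
  (forall g, closure (commensurator (Gamma y)) g) -> dense (commensurator (Gamma y)).
Proof.
move=> cl O [g Og] oO; have [|h [Ch Oh]] := cl g O; first exact: open_nbhs_nbhs.
by exists h.
Qed.

Lemma odd_dist_trans (b a c : Tp) : odd (dist a c) = odd (dist a b) (+) odd (dist b c).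
Proof.
by rewrite !(codist_odd cm _ _ y) addbA addbK.
Qed.

(** Commensurating automorphisms already identify degrees within each type, and [g] links the two
    types. *)
Lemma regular_of_type_interchanging (g : aut Tp) x :
  odd (dist x (g x)) -> regular_tree Tp.
Proof.
move=> og.
have nbrs_aut (h : aut Tp) p : (nbrs p #= nbrs (h p))%card.
  suff -> : nbrs (h p) = h @` nbrs p.
    by rewrite card_eq_sym; apply: inj_card_eq => a b _ _; exact: aut_injective.
  apply/seteqP; split=> [q pq|_ [q pq <-]]; last by rewrite /nbrs /= aut_adj.
  by exists (h^-1 q); [rewrite /nbrs /= -(aut_adj h) aut_invK|exact: (aut_invK h)].
have even (p q : Tp) : ~~ odd (dist p q) -> (nbrs p #= nbrs q)%card.
  by move=> /commensurates_transitive[h _ <-].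
have toX (p : Tp) : (nbrs p #= nbrs x)%card.
  have [o|/even//] := boolP (odd (dist p x)).
  apply: card_eq_trans (_ : nbrs p #= nbrs (g x))%card _; last first.
    by rewrite card_eq_sym.
  by apply: even; rewrite (odd_dist_trans x) o og.
by move=> p q; apply: card_eq_trans (toX p) _; rewrite card_eq_sym.
Qed.

(** Conjugation by [u] carries the stabilizer of [y] to that of [u.2 y], which is commensurable with
    it. *)
Lemma commensurates_twin_aut u : @twin_auts TT u -> commensurates (A_stab y) u.1.
Proof.
move=> uA; have [_ AM AV] := is_subgroup_twin_auts TT.
rewrite /commensurates; suff -> : conj_by u.1 (A_stab y) = A_stab (u.2 y).
  exact: commensurable_stab.
apply/seteqP; split=> [_ [_ [v [vA vy] <-] <-]|_ [v [vA vy] <-]].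
  exists (u * v * u^-1) => //; split; first by do ?apply: (AM) => //; exact: AV.
  by rewrite /= aut_funK vy.
exists (u^-1 * v * u).1; last first.
  by rewrite -[RHS](mulVKg u.1) -[in RHS](mulgK u.1 v.1) !mulgA mulgV mul1g.
exists (u^-1 * v * u) => //; split; first by do ?apply: (AM) => //; exact: AV.
by change (aut_inv u.2 (v.2 (u.2 y)) = y); rewrite vy aut_funK.
Qed.

End Commensurator.

End Density.

Theorem theorem7 (TT : twin_tree) (hthick : thick TT) (hlf : locally_finite TT)
    (hmoufang : moufang TT) (hcomm : comm_condition TT) (y : neg TT) :
  [/\ @type_preserving (pos TT) `<=` closure (commensurator (Gamma y)),
      ~ regular_tree (pos TT) -> dense (commensurator (Gamma y)) &
      regular_tree (pos TT) ->
        (exists2 u, @twin_auts TT u & type_interchanging u) ->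
        dense (commensurator (Gamma y))].
Proof.
have approx := commensurates_approx_even hthick hlf hmoufang y.
have clos := closure_commensurator hthick hlf hmoufang (y := y).
split.
- move=> g tg; apply: clos => F sF; have [_ [x0 Fx0] _] := sF.
  by apply: approx sF Fx0 _; exact: tg.
- move=> nreg; apply: dense_commensurator => g; apply: clos => F sF.
  have [_ [x0 Fx0] _] := sF; apply: approx sF Fx0 _; apply/negP => og.
  exact/nreg/(regular_of_type_interchanging hthick hlf hmoufang y og).
- move=> _ [u uA [ui _]]; apply: dense_commensurator => g; apply: clos => F sF.
  have [_ [x0 Fx0] _] := sF.
  have [og|/(approx _ _ _ sF Fx0)//] := boolP (odd (dist x0 (g x0))).
  (* Composing with [u.1^-1] makes the displacement of [x0] even; the approximation is then
     multiplied back by [u.1]. *)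
  have [|h Ch hF] := approx (u.1^-1 * g)%g F x0 sF Fx0.
    rewrite -(aut_dist u.1) autM (aut_invK u.1) (odd_dist_trans y x0) og.
    by have := ui x0; rewrite /same_type negbK dist_sym => ->.
  exists (u.1 * h)%g; first exact: commensuratesM (commensurates_twin_aut hlf y uA) Ch.
  by move=> p Fp; rewrite autM hF // autM (aut_invK u.1).
Qed.
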